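(* Let $m\in\{4,8\}$, let $k$ be a positive integer with $l-m-1>0$, where $l=k\delta(m)$ (so $l=4k$ if $m=4$ and $l=8k$ if $m=8$), and let $\{P_0,P_1,\dots,P_m\}$ be a symmetric Clifford system on $\mathbb{R}^{2l}$, with associated vector bundle $\eta$ over $S^{l-1}$. (i) If $m=4$ and $\mathrm{Tr}(P_0P_1P_2P_3P_4)=-8(2p-k+2)$ with $0\le p\le k-1$, then the characteristic map $\chi:S^{4k-2}\to \mathrm{SO}(4k-4)$ of $\eta$ is given by $$\chi(z)(X)=X-2\Big(\langle X,W\rangle_p(1+z_k)^{-2}\Big)\ast_p W,$$ where $z=(z_1,\dots,z_k)\in S^{4k-2}$, the equator of $S^{4k-1}\subset\mathbb{H}^k$ given by $\mathrm{Re}(z_k)=0$, $W=(z_1,\dots,z_{k-1})$, and $X\in\mathbb{H}^{k-1}\cong\mathbb{R}^{4k-4}$. (ii) If $m=8$ and $\mathrm{Tr}(P_0P_1\cdots P_8)=-16(2p-k+2)$ with $0\le p\le k-1$, then the characteristic map $\chi:S^{8k-2}\to \mathrm{SO}(8k-8)$ of $\eta$ is given by $$\chi(z)(X)=X-2\Big(\langle X,W\rangle_p(1+z_k)^{-2}\Big)\ast_p W,$$ where $z=(z_1,\dots,z_k)\in S^{8k-2}$, the equator of $S^{8k-1}\subset\mathbb{O}^k$ given by $\mathrm{Re}(z_k)=0$, $W=(z_1,\dots,z_{k-1})$, and $X\in\mathbb{O}^{k-1}\cong\mathbb{R}^{8k-8}$.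
   Context: Symmetric Clifford system: symmetric endomorphisms $P_0,\dots,P_m$ of $\mathbb{R}^{2l}$ with $P_iP_j+P_jP_i=2\delta_{ij}I_{2l}$. Here $l=k\delta(m)$, with $\delta(m)$ the dimension of an irreducible module of the Clifford algebra $\mathcal{C}_{m-1}$; $\delta(4)=4$, $\delta(8)=8$. Up to algebraic equivalence (conjugation by an orthogonal transformation of $\mathbb{R}^{2l}=\mathbb{R}^l\oplus\mathbb{R}^l$) one writes $P_0(z,w)=(z,-w)$, $P_1(z,w)=(w,z)$, $P_{1+\alpha}(z,w)=(E_\alpha w,-E_\alpha z)$ for $1\le\alpha\le m-1$, where $E_1,\dots,E_{m-1}$ are skew-symmetric orthogonal transformations of $\mathbb{R}^l$ with $E_\alpha E_\beta+E_\beta E_\alpha=-2\delta_{\alpha\beta}I_l$. The bundle $\eta$ is the subbundle of $TS^{l-1}$ whose fiber at $z\in S^{l-1}$ is the orthogonal complement in $\mathbb{R}^l$ of $\mathrm{span}\{z,E_1z,\dots,E_{m-1}z\}$. Let $\mathbb{F}=\mathbb{H}$ if $m=4$ and $\mathbb{F}=\mathbb{O}$ if $m=8$. For the given trace value, $\mathbb{R}^l$ is identified with $\mathbb{F}^k$ so that $$E_\alpha(z)=(e_\alpha z_1,\dots,e_\alpha z_p,-e_\alpha z_{p+1},\dots,-e_\alpha z_{k-1},e_\alpha z_k),\quad 1\le\alpha\le m-1,$$ where $(e_1,e_2,e_3)=(\mathrm{i},\mathrm{j},\mathrm{k})$ for $\mathbb{H}$, and for $\mathbb{O}=\mathbb{H}\oplus\mathbb{H}$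 with product $(a,b)(c,d)=(ac-\bar d b,\,da+b\bar c)$, $e_1=(\mathrm{i},0),e_2=(\mathrm{j},0),e_3=(\mathrm{k},0),e_4=(0,1),e_5=(0,\mathrm{i}),e_6=(0,\mathrm{j}),e_7=(0,\mathrm{k})$. For $X=(x_1,\dots,x_{k-1})$, $W=(w_1,\dots,w_{k-1})\in\mathbb{F}^{k-1}$ and $\varepsilon\in\mathbb{F}$: $$\langle X,W\rangle_p=\sum_{i=1}^p x_i\overline{w}_i+\sum_{j=p+1}^{k-1}w_j\overline{x}_j,\qquad \varepsilon\ast_pW=(\varepsilon w_1,\dots,\varepsilon w_p,\overline{\varepsilon}w_{p+1},\dots,\overline{\varepsilon}w_{k-1}).$$ Characteristic map (in the sense of Steenrod): let $\xi$ be an oriented Euclidean vector bundle of rank $r$ over $S^n$, $N\in S^n$ the north pole and $S^{n-1}$ the corresponding equator. A map $\chi:S^{n-1}\to\mathrm{SO}(r)$ is the characteristic map of $\xi$ if there are fiberwise isometric trivializations $\psi_1:(S^n\setminus\{-N\})\times\mathbb{R}^r\to\xi$ and $\psi_2:(S^n\setminus\{N\})\times\mathbb{R}^r\to\xi$ (over the respective open sets) with $\psi_1^{-1}(\psi_2(z,X))=(z,\chi(z)X)$ for $z\in S^{n-1}$. Here $N=(0,\dots,0,1)\in\mathbb{F}^k$. *)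

(* Defs.v *)
(* Conventions:
   - R^l is 'cV[R]_l, and an endomorphism of R^l is a square matrix acting by
     left multiplication on columns, so that a composite of endomorphisms is
     the matrix product in the same order;
   - the algebra F (quaternions or octonions) is the space of row vectors of
     its real coordinates, with coordinate 0 the real part;
   - F^k is the space of matrices with k rows, the i-th row being z_i.
   Indices start at 0, so that z_1, ..., z_p are the rows of index i < p, and
   z_k is the row ord_max. *)
From HB Require Import structures.
From mathcomp Require Import all_boot all_order all_algebra.
From mathcomp Require Import all_classical all_reals all_analysis.
Set Implicit Arguments.
Unset Strict Implicit.
Unset Printing Implicit Defensive.
Import Order.TTheory GRing.Theory Num.Theory.
Import numFieldTopology.Exports numFieldNormedType.Exports.
Local Open Scope classical_set_scope.
Local Open Scope ring_scope.

Definition dot (R : realType) (a b : nat) (X Y : 'M[R]_(a, b)) : R :=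
  \sum_i \sum_j X i j * Y i j.

Definition sphere (R : realType) (a b : nat) : set 'M[R]_(a, b) :=
  [set z | dot z z = 1].
Arguments sphere {R a b}.

Definition equator (R : realType) (a b : nat) (N : 'M[R]_(a, b)) :
    set 'M[R]_(a, b) :=
  [set z | sphere z /\ dot z N = 0].

(** * Clifford systems and the bundle eta *)

Definition clifford_system (R : realType) (m n : nat)
    (P : 'I_m.+1 -> 'M[R]_n) : Prop :=
  (forall i, (P i)^T = P i) /\
  (forall i j, P i *m P j + P j *m P i = (2 * (i == j)%:R)%:M).

(* The operators E_1, ..., E_q, with q = m - 1, are indexed by 'I_q. *)
Definition skew_clifford (R : realType) (q l : nat)
    (E : 'I_q -> 'M[R]_l) : Prop :=
  [/\ forall a, (E a)^T = - E a,
      forall a, (E a)^T *m E a = 1%:M &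
      forall a b, E a *m E b + E b *m E a = (- (2 * (a == b)%:R))%:M].

(* P (with m = q + 1) is conjugated by the orthogonal matrix A to
   (z,w) |-> (z,-w), (z,w) |-> (w,z) and (z,w) |-> (E_a w, - E_a z). *)
Definition clifford_normal_form (R : realType) (q l : nat)
    (P : 'I_q.+2 -> 'M[R]_(l + l)) (A : 'M[R]_(l + l))
    (E : 'I_q -> 'M[R]_l) : Prop :=
  [/\ A^T *m A = 1%:M /\ skew_clifford E,
      A *m P ord0 *m A^T = block_mx 1%:M 0 0 (- 1%:M),
      A *m P (lift ord0 ord0) *m A^T = block_mx 0 1%:M 1%:M 0 &
      forall a : 'I_q, A *m P (lift ord0 (lift ord0 a)) *m A^T
                       = block_mx 0 (E a) (- E a) 0].

Definition eta_fiber (R : realType) (q l : nat) (E : 'I_q -> 'M[R]_l)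
    (z : 'cV[R]_l) : set 'cV[R]_l :=
  [set Y | forall V : 'cV[R]_l,
     V \in <<z :: [seq E a *m z | a : 'I_q]>>%VS -> dot Y V = 0].

(** * Characteristic maps of subbundles of a trivial bundle *)

(* A Euclidean vector bundle over a sphere is given here by its fibers
   [fib z], which are subspaces of a fixed Euclidean space V carrying the
   induced metric; its total space over U is a subspace of U x V. *)
Definition total_space (R : realType) (a b c d : nat)
    (U : set 'M[R]_(a, b)) (fib : 'M[R]_(a, b) -> set 'M[R]_(c, d)) :
    set ('M[R]_(a, b) * 'M[R]_(c, d)) :=
  [set v | U v.1 /\ fib v.1 v.2].

(* psi is a homeomorphism from U x R^r (R^r being 'M_(r, s)) to the total
   space over U, with inverse psi', which covers the identity of U and is a
   linear isometry on each fiber. *)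
Definition isometric_trivialization (R : realType) (a b c d r s : nat)
    (U : set 'M[R]_(a, b)) (fib : 'M[R]_(a, b) -> set 'M[R]_(c, d))
    (psi : 'M[R]_(a, b) * 'M[R]_(r, s) -> 'M[R]_(a, b) * 'M[R]_(c, d))
    (psi' : 'M[R]_(a, b) * 'M[R]_(c, d) -> 'M[R]_(a, b) * 'M[R]_(r, s)) :
    Prop :=
  [/\ [/\ {within U `*` setT, continuous psi},
          {within total_space U fib, continuous psi'},
          forall u, (U `*` setT) u ->
            total_space U fib (psi u) /\ psi' (psi u) = u &
          forall v, total_space U fib v ->
            (U `*` setT) (psi' v) /\ psi (psi' v) = v],
      forall z X, U z -> (psi (z, X)).1 = z,
      forall z, U z -> linear (fun X => (psi (z, X)).2) &
      forall z X Y, U z -> dot (psi (z, X)).2 (psi (z, Y)).2 = dot X Y].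

Definition special_orthogonal (R : realType) (r s : nat)
    (f : 'M[R]_(r, s) -> 'M[R]_(r, s)) : Prop :=
  [/\ linear f, forall X Y, dot (f X) (f Y) = dot X Y & \det (lin_mx f) = 1].

(* The values of chi outside the equator are irrelevant. *)
Definition is_characteristic_map (R : realType) (a b c d r s : nat)
    (fib : 'M[R]_(a, b) -> set 'M[R]_(c, d)) (N : 'M[R]_(a, b))
    (chi : 'M[R]_(a, b) -> 'M[R]_(r, s) -> 'M[R]_(r, s)) : Prop :=
  (forall z, equator N z -> special_orthogonal (chi z)) /\
  exists psi1 psi1' psi2 psi2',
    [/\ isometric_trivialization (sphere `\ (- N)) fib psi1 psi1',
        isometric_trivialization (sphere `\ N) fib psi2 psi2' &
        forall z X, equator N z -> psi1' (psi2 (z, X)) = (z, chi z X)].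

(** * Quaternions and octonions *)

Definition fconj (R : realType) (q : nat) (x : 'rV[R]_q.+1) : 'rV[R]_q.+1 :=
  \row_j (if j == ord0 then x 0 j else - x 0 j).

Definition fone (R : realType) (q : nat) : 'rV[R]_q.+1 := delta_mx 0 ord0.
Arguments fone {R q}.

(* e_1, ..., e_q : the standard basis without its element 1. *)
Definition funit (R : realType) (q : nat) (a : 'I_q) : 'rV[R]_q.+1 :=
  delta_mx 0 (lift ord0 a).

Definition falg_inv (R : realType) (q : nat) (x : 'rV[R]_q.+1) : 'rV[R]_q.+1 :=
  (dot x x)^-1 *: fconj x.

(* Coordinates with respect to 1, i, j, k. *)
Definition qmul (R : realType) (x y : 'rV[R]_4) : 'rV[R]_4 :=
  let x_ n := x 0 (@inord 3 n) in
  let y_ n := y 0 (@inord 3 n) in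
  \row_(t < 4) nth 0
    [:: x_ 0%N * y_ 0%N - x_ 1%N * y_ 1%N - x_ 2%N * y_ 2%N - x_ 3%N * y_ 3%N;
        x_ 0%N * y_ 1%N + x_ 1%N * y_ 0%N + x_ 2%N * y_ 3%N - x_ 3%N * y_ 2%N;
        x_ 0%N * y_ 2%N - x_ 1%N * y_ 3%N + x_ 2%N * y_ 0%N + x_ 3%N * y_ 1%N;
        x_ 0%N * y_ 3%N + x_ 1%N * y_ 2%N - x_ 2%N * y_ 1%N + x_ 3%N * y_ 0%N]
    t.

(* (a, b)(c, d) = (ac - conj(d) b, da + b conj(c)), the pair (a, b) being
   row_mx a b; the basis funit is then
   (i,0), (j,0), (k,0), (0,1), (0,i), (0,j), (0,k). *)
Definition omul (R : realType) (x y : 'rV[R]_8) : 'rV[R]_8 :=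
  let a := @lsubmx R 1 4 4 x in
  let b := @rsubmx R 1 4 4 x in
  let c := @lsubmx R 1 4 4 y in
  let d := @rsubmx R 1 4 4 y in
  @row_mx R 1 4 4 (qmul a c - qmul (fconj d) b) (qmul d a + qmul b (fconj c)).

(** * The explicit model on F^k, with k = n + 1 and F of dimension q + 1,
    relative to the multiplication mul of F *)

Definition std_E (R : realType) (q n : nat)
    (mul : 'rV[R]_q.+1 -> 'rV[R]_q.+1 -> 'rV[R]_q.+1) (p : nat)
    (a : 'I_q) (z : 'M[R]_(n.+1, q.+1)) : 'M[R]_(n.+1, q.+1) :=
  \matrix_(i < n.+1)
    (if (i < p)%N || (i == ord_max) then mul (funit R a) (row i z)
     else - mul (funit R a) (row i z)).

(* Phi : R^l -> F^k is a linear isometry, and E_1, ..., E_q become the above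
   operators under it. *)
Definition std_identification (R : realType) (q n l : nat)
    (mul : 'rV[R]_q.+1 -> 'rV[R]_q.+1 -> 'rV[R]_q.+1) (p : nat)
    (E : 'I_q -> 'M[R]_l) (Phi : 'cV[R]_l -> 'M[R]_(n.+1, q.+1)) : Prop :=
  [/\ linear Phi, bijective Phi,
      forall x y, dot (Phi x) (Phi y) = dot x y &
      forall a x, Phi (E a *m x) = std_E mul p a (Phi x)].

Definition north_pole (R : realType) (q n : nat) : 'M[R]_(n.+1, q.+1) :=
  delta_mx ord_max ord0.
Arguments north_pole {R q n}.

Definition herm (R : realType) (q n : nat)
    (mul : 'rV[R]_q.+1 -> 'rV[R]_q.+1 -> 'rV[R]_q.+1) (p : nat)
    (X W : 'M[R]_(n, q.+1)) : 'rV[R]_q.+1 :=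
  \sum_(i < n | (i < p)%N) mul (row i X) (fconj (row i W)) +
  \sum_(i < n | (p <= i)%N) mul (row i W) (fconj (row i X)).

Definition star (R : realType) (q n : nat)
    (mul : 'rV[R]_q.+1 -> 'rV[R]_q.+1 -> 'rV[R]_q.+1) (p : nat)
    (e : 'rV[R]_q.+1) (W : 'M[R]_(n, q.+1)) : 'M[R]_(n, q.+1) :=
  \matrix_(i < n)
    (if (i < p)%N then mul e (row i W) else mul (fconj e) (row i W)).

Definition char_map (R : realType) (q n : nat)
    (mul : 'rV[R]_q.+1 -> 'rV[R]_q.+1 -> 'rV[R]_q.+1) (p : nat)
    (z : 'M[R]_(n.+1, q.+1)) (X : 'M[R]_(n, q.+1)) : 'M[R]_(n, q.+1) :=
  let W := \matrix_(i < n) row (widen_ord (leqnSn n) i) z in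
  let u := falg_inv (fone + row ord_max z) in
  X - 2 *: star mul p (mul (herm mul p X W) (mul u u)) W.

(* Main.v *)
(* Over z with z_k different from -1 the fibre of eta is the set of the (Y, y)
   with <Y, W>_p + y conj(z_k) = 0. Writing a = 1 + z_k and h = <X, W>_p, it is
   parametrized isometrically by
     X |-> (X - ((h a) / |a|^2) * W, - ((h a) a) / |a|^2),
   with inverse (Y, y) |-> Y - ((y conj(a)) / |a|^2) * W. The same formula at -z
   trivializes eta away from the north pole, and comparing the two over the
   equator gives chi. All identities involved are linear in h and h z_k, because
   (h z_k) z_k = 2 Re(z_k) h z_k - |z_k|^2 h in a composition algebra.

   For the algebraic part, R^{2l}, respectively R^l, is split greedily into
   orthonormal blocks invariant under P_0 and P_1, respectively under the E_a.
   A block of the second kind is spanned by v and the e E_a v, where e = 1 or -1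
   and v is a common eigenvector of e E_1 ... e E_q and, for octonions, of three
   commuting products of three operators; then the E_a act on the block as e
   times the left multiplications by the e_a. As e_1 ... e_q acts as -1 on F,
   the trace of P_0 ... P_m determines the number of blocks with e = 1. *)
Require Import Defs.
From HB Require Import structures.
From mathcomp Require Import all_boot all_order all_algebra.
From mathcomp Require Import all_classical all_reals all_analysis.
From mathcomp Require Import perm ring lra.
Set Implicit Arguments.
Unset Strict Implicit.
Unset Printing Implicit Defensive.
Import Order.TTheory GRing.Theory Num.Theory.
Import numFieldTopology.Exports numFieldNormedType.Exports.
Local Open Scope ring_scope.

(** * Scalar products and composition algebras *)

(** Octonions do not associate, so no step may rest on regrouping products. All that is used of F is
    gathered in [composition_algebra]; over a given z, the element h is multiplied only from the
    right, and only by elements of one plane spanned by 1 and an imaginary unit, where alternativity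
    replaces associativity. The trace value has this origin: 2p - k + 2 = (p + 1) - (k - p - 1) is
    the excess of blocks with e = 1, namely the first p rows and the last one, over those with e =
    -1. Each block contributes - e (q + 1) to the trace of E_1 ... E_q, and P_0 ... P_m has twice
    that trace, whence the factors -8 and -16. Only the number of blocks of each kind is known, so a
    permutation has to bring them into the prescribed order. The trivializations make chi(z)
    orthogonal but leave the sign of its determinant open; a linear square root of chi(z) settles
    it. *)

Section LinearFunctions.
Variables (R : pzRingType) (U V : lmodType R) (f : U -> V).
Hypothesis f_lin : linear f.

(** The notions of the theorem use linearity as a predicate on bare functions; packing such a
    function gives access to the lemmas on bundled linear maps. *)
Lemma linear_packed : exists g : {linear U -> V}, f = g :> (U -> V).
Proof.
pose g : {linear U -> V} := HB.pack f (GRing.isLinear.Build R U V *:%R f f_lin).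
by exists g.
Qed.

Lemma linD x y : f (x + y) = f x + f y.
Proof. by have [g ->] := linear_packed; rewrite linearD. Qed.

Lemma linB x y : f (x - y) = f x - f y.
Proof. by have [g ->] := linear_packed; rewrite linearB. Qed.

Lemma linN x : f (- x) = - f x.
Proof. by have [g ->] := linear_packed; rewrite linearN. Qed.

Lemma lin0 : f 0 = 0.
Proof. by have [g ->] := linear_packed; rewrite linear0. Qed.

Lemma linZ c x : f (c *: x) = c *: f x.
Proof. by have [g ->] := linear_packed; rewrite linearZ. Qed.

Lemma lin_sum I (r : seq I) (P : pred I) (F : I -> U) :
  f (\sum_(i <- r | P i) F i) = \sum_(i <- r | P i) f (F i).
Proof. by have [g ->] := linear_packed; rewrite linear_sum. Qed.

End LinearFunctions.

Section Dot.
Variables (R : realType) (a b : nat).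
Implicit Types X Y Z : 'M[R]_(a, b).

Lemma dotE X Y : dot X Y = \tr (X *m Y^T).
Proof.
rewrite /dot /mxtrace; apply: eq_bigr => i _.
by rewrite mxE; apply: eq_bigr => j _; rewrite mxE.
Qed.

Lemma dotC X Y : dot X Y = dot Y X.
Proof. by rewrite !dotE -mxtrace_tr trmx_mul trmxK. Qed.

Lemma dot_linear Y : linear (fun X => dot X Y : R^o).
Proof. by move=> c X Z; rewrite !dotE mulmxDl -scalemxAl linearD linearZ. Qed.

Lemma dotDl X Y Z : dot (X + Y) Z = dot X Z + dot Y Z.
Proof. exact: linD (dot_linear Z) X Y. Qed.
Lemma dotBl X Y Z : dot (X - Y) Z = dot X Z - dot Y Z.
Proof. exact: linB (dot_linear Z) X Y. Qed.
Lemma dotNl X Z : dot (- X) Z = - dot X Z.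
Proof. exact: linN (dot_linear Z) X. Qed.
Lemma dotZl c X Z : dot (c *: X) Z = c * dot X Z.
Proof. exact: linZ (dot_linear Z) c X. Qed.
Lemma dot0l Z : dot 0 Z = 0.
Proof. exact: lin0 (dot_linear Z). Qed.
Lemma dot_suml I (r : seq I) (P : pred I) (F : I -> 'M[R]_(a, b)) Z :
  dot (\sum_(i <- r | P i) F i) Z = \sum_(i <- r | P i) dot (F i) Z.
Proof. by elim/big_rec2: _ => [|i x Y _ <-]; rewrite ?dot0l ?dotDl. Qed.

Lemma dotDr X Y Z : dot Z (X + Y) = dot Z X + dot Z Y.
Proof. by rewrite !(dotC Z) dotDl. Qed.
Lemma dotBr X Y Z : dot Z (X - Y) = dot Z X - dot Z Y.
Proof. by rewrite !(dotC Z) dotBl. Qed.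
Lemma dotNr X Z : dot Z (- X) = - dot Z X.
Proof. by rewrite !(dotC Z) dotNl. Qed.
Lemma dotZr c X Z : dot Z (c *: X) = c * dot Z X.
Proof. by rewrite !(dotC Z) dotZl. Qed.
Lemma dot_sumr I (r : seq I) (P : pred I) (F : I -> 'M[R]_(a, b)) Z :
  dot Z (\sum_(i <- r | P i) F i) = \sum_(i <- r | P i) dot Z (F i).
Proof. by rewrite dotC dot_suml; apply: eq_bigr => i _; rewrite dotC. Qed.

Lemma dot_ge0 X : 0 <= dot X X.
Proof. by do 2!apply: sumr_ge0 => ? _; rewrite -expr2 sqr_ge0. Qed.

Lemma dot_eq0 X : (dot X X == 0) = (X == 0).
Proof.
apply/eqP/eqP => [X0|->]; last exact: dot0l.
apply/matrixP => i j; rewrite mxE; apply/eqP; rewrite -sqrf_eq0 expr2.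
have sum0 c : \sum_j X c j * X c j = 0.
  apply/eqP; move/eqP: X0; rewrite /dot psumr_eq0 => [/allP/(_ c)|k _].
    by rewrite mem_index_enum => /(_ isT).
  by apply: sumr_ge0 => ? _; rewrite -expr2 sqr_ge0.
move/eqP: (sum0 i); rewrite psumr_eq0 => [/allP/(_ j)|k _].
  by rewrite mem_index_enum => /(_ isT).
by rewrite -expr2 sqr_ge0.
Qed.

Lemma dot_gt0 X : (0 < dot X X) = (X != 0).
Proof. by rewrite lt0r dot_ge0 dot_eq0 andbT. Qed.

Lemma dot_sqrD X Y : dot (X + Y) (X + Y) = dot X X + 2 * dot X Y + dot Y Y.
Proof. by rewrite dotDl !dotDr (dotC Y X); ring. Qed.

Lemma dot_delta X i j : dot X (delta_mx i j) = X i j.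
Proof.
rewrite /dot (bigD1 i) //= (bigD1 j) //= mxE !eqxx mulr1.
rewrite !big1 ?addr0 // => [k /negbTE ki|k /negbTE kj].
  by apply: big1 => h _; rewrite mxE ki mulr0.
by rewrite mxE kj andbF mulr0.
Qed.

End Dot.

Lemma isometry_polar (R : realType) (a b c d : nat)
    (f : 'M[R]_(a, b) -> 'M[R]_(c, d)) :
  linear f -> (forall X, dot (f X) (f X) = dot X X) ->
  forall X Y, dot (f X) (f Y) = dot X Y.
Proof.
move=> f_lin f_norm X Y; have := f_norm (X + Y).
rewrite (linD f_lin) !dot_sqrD !f_norm => /addIr/addrI.
by apply: mulfI; rewrite pnatr_eq0.
Qed.

Section Conjugation.
Variables (R : realType) (q : nat).
Implicit Types x y : 'rV[R]_q.+1.

Lemma fconjE x : fconj x = (2 * x 0 ord0) *: fone - x.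
Proof.
apply/rowP => j; rewrite !mxE eqxx /=; case: eqP => [->|_] /=.
  by rewrite mulr1 mulr_natl mulr2n addrK.
by rewrite mulr0 sub0r.
Qed.

Lemma fconjK : involutive (@fconj R q).
Proof.
by move=> x; apply/rowP => j; rewrite !mxE; case: eqP => // _; rewrite opprK.
Qed.

Lemma fconj_linear : linear (@fconj R q).
Proof.
by move=> c x y; apply/rowP => j; rewrite !mxE; case: eqP => // _; rewrite opprD mulrN.
Qed.

Lemma dot_fconj x y : dot (fconj x) (fconj y) = dot x y.
Proof.
apply: eq_bigr => i _; apply: eq_bigr => j _; rewrite !ord1 !mxE.
by case: eqP => // _; rewrite mulrNN.
Qed.

Lemma dot_fone x : dot x fone = x 0 ord0.
Proof. exact: dot_delta. Qed.

Lemma fconj1 : fconj fone = fone :> 'rV[R]_q.+1.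
Proof.
by rewrite fconjE !mxE !eqxx mulr1 scaler_nat mulr2n addrK.
Qed.

End Conjugation.

(** These identities hold without associativity: alternativity in the form of cancellation against a
    conjugate, and conjugation as adjoint of left and right multiplication. *)
Record composition_algebra (R : realType) (q : nat)
    (mul : 'rV[R]_q.+1 -> 'rV[R]_q.+1 -> 'rV[R]_q.+1) : Prop := {
  mul_linr : forall x, linear (mul x);
  mul_linl : forall y, linear (mul^~ y);
  mul_1l : left_id fone mul;
  mul_1r : right_id fone mul;
  mul_conjK : forall x y, mul (mul x y) (fconj y) = dot y y *: x;
  conj_mulK : forall x y, mul (fconj x) (mul x y) = dot x x *: y;
  dot_mull : forall x y z, dot (mul x y) z = dot y (mul (fconj x) z);
  dot_mulr : forall x y z, dot (mul x y) z = dot x (mul z (fconj y));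
  conj_mul : forall x y, fconj (mul x y) = mul (fconj y) (fconj x)
}.

Section CompositionAlgebra.
Variables (R : realType) (q : nat).
Variable mul : 'rV[R]_q.+1 -> 'rV[R]_q.+1 -> 'rV[R]_q.+1.
Hypothesis mulP : composition_algebra mul.
Implicit Types x y z : 'rV[R]_q.+1.

Lemma fmulDr x y z : mul x (y + z) = mul x y + mul x z.
Proof. exact: linD (mul_linr mulP x) y z. Qed.
Lemma fmulBr x y z : mul x (y - z) = mul x y - mul x z.
Proof. exact: linB (mul_linr mulP x) y z. Qed.
Lemma fmulNr x y : mul x (- y) = - mul x y.
Proof. exact: linN (mul_linr mulP x) y. Qed.
Lemma fmulZr x c y : mul x (c *: y) = c *: mul x y.
Proof. exact: linZ (mul_linr mulP x) c y. Qed.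
Lemma fmulDl x y z : mul (x + y) z = mul x z + mul y z.
Proof. exact: linD (mul_linl mulP z) x y. Qed.
Lemma fmulBl x y z : mul (x - y) z = mul x z - mul y z.
Proof. exact: linB (mul_linl mulP z) x y. Qed.
Lemma fmulNl x y : mul (- x) y = - mul x y.
Proof. exact: linN (mul_linl mulP y) x. Qed.
Lemma fmulZl c x y : mul (c *: x) y = c *: mul x y.
Proof. exact: linZ (mul_linl mulP y) c x. Qed.
Lemma dot_mul x y : dot (mul x y) (mul x y) = dot x x * dot y y.
Proof. by rewrite (dot_mull mulP) (conj_mulK mulP) dotZr. Qed.

(* Right alternativity, in the form of the quadratic equation satisfied by y. *)
Lemma mul_mul x y : mul (mul x y) y = (2 * y 0 ord0) *: mul x y - dot y y *: x.
Proof.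
have := mul_conjK mulP x y; rewrite fconjE fmulBr fmulZr (mul_1r mulP).
by move=> <-; rewrite opprB addrC subrK.
Qed.

Lemma sqrE y : mul y y = (2 * y 0 ord0) *: y - dot y y *: fone.
Proof. by have := mul_mul fone y; rewrite !(mul_1l mulP). Qed.

Lemma mul_sqr x y : mul x (mul y y) = mul (mul x y) y.
Proof. by rewrite sqrE fmulBr !fmulZr (mul_1r mulP) mul_mul. Qed.

(** Moving y across the product replaces it by its conjugate, and y + conj(y) = 2 Re(y). *)
Lemma dot_mul_self x y : dot x (mul x y) = y 0 ord0 * dot x x.
Proof.
have := dot_mulr mulP x y x.
rewrite dotC fconjE fmulBr fmulZr (mul_1r mulP) dotBr dotZr => e.
by apply: (mulfI (x := 2%:R)); rewrite ?pnatr_eq0 // mulrA; lra.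
Qed.

End CompositionAlgebra.

(** * Quaternions and octonions *)

Section Coordinates.
Variables (R : realType) (q : nat).
Implicit Types x y : 'rV[R]_q.+1.

(** With numerals as indices, the multiplication tables become rewriting rules, and the identities
    of the algebras are left to [ring]. *)
Definition crd x (n : nat) : R := x 0 (inord n).

Lemma crdP x y : (forall n, (n < q.+1)%N -> crd x n = crd y n) -> x = y.
Proof.
by move=> e; apply/rowP => j; have := e j (ltn_ord j); rewrite /crd inord_val.
Qed.

Lemma crdD x y n : crd (x + y) n = crd x n + crd y n.
Proof. by rewrite /crd !mxE. Qed.
Lemma crdN x n : crd (- x) n = - crd x n.
Proof. by rewrite /crd !mxE. Qed.
Lemma crdZ a x n : crd (a *: x) n = a * crd x n.
Proof. by rewrite /crd !mxE. Qed.
Lemma inord_eq0 n : (n < q.+1)%N -> (inord n == ord0 :> 'I_q.+1) = (n == 0%N).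
Proof. by move=> lt; rewrite -val_eqE /= inordK. Qed.

Lemma crd_conj n (lt : (n < q.+1)%N) x :
  crd (fconj x) n = if n == 0%N then crd x n else - crd x n.
Proof. by rewrite /crd mxE inord_eq0. Qed.

Lemma crd_one n : (n < q.+1)%N -> crd fone n = (n == 0%N)%:R.
Proof. by move=> lt; rewrite /crd mxE inord_eq0. Qed.

Lemma dot_crd x y : dot x y = \sum_(i < q.+1) crd x i * crd y i.
Proof.
rewrite /dot big_ord1; apply: eq_bigr => j _.
by rewrite /crd inord_val ord1.
Qed.

End Coordinates.

Section Quaternions.
Variable R : realType.
Implicit Types x y z : 'rV[R]_4.

Lemma crd4P x y : crd x 0 = crd y 0 -> crd x 1 = crd y 1 ->
  crd x 2 = crd y 2 -> crd x 3 = crd y 3 -> x = y.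
Proof. by move=> *; apply: crdP => -[|[|[|[|]]]]. Qed.

Lemma crd_qmul0 x y : crd (qmul x y) 0 =
  crd x 0 * crd y 0 - crd x 1 * crd y 1 - crd x 2 * crd y 2 - crd x 3 * crd y 3.
Proof. by rewrite {1}/crd !mxE inordK. Qed.

Lemma crd_qmul1 x y : crd (qmul x y) 1 =
  crd x 0 * crd y 1 + crd x 1 * crd y 0 + crd x 2 * crd y 3 - crd x 3 * crd y 2.
Proof. by rewrite {1}/crd !mxE inordK. Qed.

Lemma crd_qmul2 x y : crd (qmul x y) 2 =
  crd x 0 * crd y 2 - crd x 1 * crd y 3 + crd x 2 * crd y 0 + crd x 3 * crd y 1.
Proof. by rewrite {1}/crd !mxE inordK. Qed.

Lemma crd_qmul3 x y : crd (qmul x y) 3 =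
  crd x 0 * crd y 3 + crd x 1 * crd y 2 - crd x 2 * crd y 1 + crd x 3 * crd y 0.
Proof. by rewrite {1}/crd !mxE inordK. Qed.

Lemma dot4 x y : dot x y = crd x 0 * crd y 0 + crd x 1 * crd y 1
  + crd x 2 * crd y 2 + crd x 3 * crd y 3.
Proof. by rewrite dot_crd !big_ord_recr big_ord0 /= add0r. Qed.

Definition crd4E := (crd_qmul0, crd_qmul1, crd_qmul2, crd_qmul3,
  crdD, crdN, crdZ, @crd_conj R 3 0 isT,
  @crd_conj R 3 1 isT, @crd_conj R 3 2 isT, @crd_conj R 3 3 isT,
  @crd_one R 3 0 isT, @crd_one R 3 1 isT, @crd_one R 3 2 isT,
  @crd_one R 3 3 isT, dot4).

Lemma qmul_composition : composition_algebra (@qmul R).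
Proof.
split.
- by move=> x c y z; apply: crd4P; rewrite !crd4E; ring.
- by move=> x c y z; apply: crd4P; rewrite !crd4E; ring.
- by move=> x; apply: crd4P; rewrite !crd4E /=; ring.
- by move=> x; apply: crd4P; rewrite !crd4E /=; ring.
- by move=> x y; apply: crd4P; rewrite !crd4E /=; ring.
- by move=> x y; apply: crd4P; rewrite !crd4E /=; ring.
- by move=> x y z; rewrite !crd4E /=; ring.
- by move=> x y z; rewrite !crd4E /=; ring.
- by move=> x y; apply: crd4P; rewrite !crd4E /=; ring.
Qed.

End Quaternions.

Section Octonions.
Variable R : realType.
Implicit Types x y z : 'rV[R]_8.

Lemma crd8P x y : crd x 0 = crd y 0 -> crd x 1 = crd y 1 ->
  crd x 2 = crd y 2 -> crd x 3 = crd y 3 -> crd x 4 = crd y 4 ->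
  crd x 5 = crd y 5 -> crd x 6 = crd y 6 -> crd x 7 = crd y 7 -> x = y.
Proof. by move=> *; apply: crdP => -[|[|[|[|[|[|[|[|]]]]]]]]. Qed.

Lemma inord_lshift n : (n < 4)%N ->
  inord n = lshift 4 (inord n : 'I_4) :> 'I_(4 + 4).
Proof. by move=> lt; apply: val_inj; rewrite /= !inordK //; case: n lt => [|[|[|[|]]]]. Qed.

Lemma inord_rshift n : (n < 4)%N ->
  inord (n + 4) = rshift 4 (inord n : 'I_4) :> 'I_(4 + 4).
Proof. by move=> lt; apply: val_inj; rewrite /= !inordK // 1?addnC //; case: n lt => [|[|[|[|]]]]. Qed.

Lemma crd_lsub n (lt : (n < 4)%N) x :
  crd (lsubmx (x : 'rV_(4 + 4))) n = crd x n.
Proof. by rewrite /crd mxE -inord_lshift. Qed.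

Lemma crd_rsub n m (lt : (n < 4)%N) (mE : m = (n + 4)%N) x :
  crd (rsubmx (x : 'rV_(4 + 4))) n = crd x m.
Proof. by rewrite mE /crd mxE -inord_rshift. Qed.

Lemma crd_row_l (a b : 'rV[R]_4) n : (n < 4)%N ->
  crd (@row_mx R 1 4 4 a b : 'rV_8) n = crd a n.
Proof. by move=> lt; rewrite /crd inord_lshift //; exact: row_mxEl. Qed.

Lemma crd_row_r (a b : 'rV[R]_4) n : (n < 4)%N ->
  crd (@row_mx R 1 4 4 a b : 'rV_8) (n + 4) = crd b n.
Proof. by move=> lt; rewrite /crd inord_rshift //; exact: row_mxEr. Qed.

Let crd_half := (crd_qmul0, crd_qmul1, crd_qmul2, crd_qmul3, crdD, crdN,
  @crd_conj R 3 0 isT, @crd_conj R 3 1 isT, @crd_conj R 3 2 isT,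
  @crd_conj R 3 3 isT,
  @crd_lsub 0 isT, @crd_lsub 1 isT, @crd_lsub 2 isT, @crd_lsub 3 isT,
  @crd_rsub 0 4 isT erefl, @crd_rsub 1 5 isT erefl, @crd_rsub 2 6 isT erefl, @crd_rsub 3 7 isT erefl).

Local Notation o x n := (crd x n%N).

Lemma crd_omul0 x y : o (omul x y) 0 =
  o x 0 * o y 0 - o x 1 * o y 1 - o x 2 * o y 2 - o x 3 * o y 3
  - o x 4 * o y 4 - o x 5 * o y 5 - o x 6 * o y 6 - o x 7 * o y 7.
Proof. by rewrite /omul (@crd_row_l _ _ 0) // !crd_half /=; ring. Qed.

Lemma crd_omul1 x y : o (omul x y) 1 =
  o x 0 * o y 1 + o x 1 * o y 0 + o x 2 * o y 3 - o x 3 * o y 2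
  + o x 4 * o y 5 - o x 5 * o y 4 - o x 6 * o y 7 + o x 7 * o y 6.
Proof. by rewrite /omul (@crd_row_l _ _ 1) // !crd_half /=; ring. Qed.

Lemma crd_omul2 x y : o (omul x y) 2 =
  o x 0 * o y 2 - o x 1 * o y 3 + o x 2 * o y 0 + o x 3 * o y 1
  + o x 4 * o y 6 + o x 5 * o y 7 - o x 6 * o y 4 - o x 7 * o y 5.
Proof. by rewrite /omul (@crd_row_l _ _ 2) // !crd_half /=; ring. Qed.

Lemma crd_omul3 x y : o (omul x y) 3 =
  o x 0 * o y 3 + o x 1 * o y 2 - o x 2 * o y 1 + o x 3 * o y 0
  + o x 4 * o y 7 - o x 5 * o y 6 + o x 6 * o y 5 - o x 7 * o y 4.
Proof. by rewrite /omul (@crd_row_l _ _ 3) // !crd_half /=; ring. Qed.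

Lemma crd_omul4 x y : o (omul x y) 4 =
  o x 0 * o y 4 - o x 1 * o y 5 - o x 2 * o y 6 - o x 3 * o y 7
  + o x 4 * o y 0 + o x 5 * o y 1 + o x 6 * o y 2 + o x 7 * o y 3.
Proof. by rewrite /omul (@crd_row_r _ _ 0) // !crd_half /=; ring. Qed.

Lemma crd_omul5 x y : o (omul x y) 5 =
  o x 0 * o y 5 + o x 1 * o y 4 - o x 2 * o y 7 + o x 3 * o y 6
  - o x 4 * o y 1 + o x 5 * o y 0 - o x 6 * o y 3 + o x 7 * o y 2.
Proof. by rewrite /omul (@crd_row_r _ _ 1) // !crd_half /=; ring. Qed.

Lemma crd_omul6 x y : o (omul x y) 6 =
  o x 0 * o y 6 + o x 1 * o y 7 + o x 2 * o y 4 - o x 3 * o y 5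
  - o x 4 * o y 2 + o x 5 * o y 3 + o x 6 * o y 0 - o x 7 * o y 1.
Proof. by rewrite /omul (@crd_row_r _ _ 2) // !crd_half /=; ring. Qed.

Lemma crd_omul7 x y : o (omul x y) 7 =
  o x 0 * o y 7 - o x 1 * o y 6 + o x 2 * o y 5 + o x 3 * o y 4
  - o x 4 * o y 3 - o x 5 * o y 2 + o x 6 * o y 1 + o x 7 * o y 0.
Proof. by rewrite /omul (@crd_row_r _ _ 3) // !crd_half /=; ring. Qed.

Lemma dot8 x y : dot x y = o x 0 * o y 0 + o x 1 * o y 1
  + o x 2 * o y 2 + o x 3 * o y 3 + o x 4 * o y 4 + o x 5 * o y 5
  + o x 6 * o y 6 + o x 7 * o y 7.
Proof. by rewrite dot_crd !big_ord_recr big_ord0 /= add0r. Qed.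

Definition crd8E := (crd_omul0, crd_omul1, crd_omul2, crd_omul3, crd_omul4,
  crd_omul5, crd_omul6, crd_omul7, crdD, crdN, crdZ, @crd_conj R 7 0 isT,
  @crd_conj R 7 1 isT, @crd_conj R 7 2 isT, @crd_conj R 7 3 isT,
  @crd_conj R 7 4 isT, @crd_conj R 7 5 isT, @crd_conj R 7 6 isT,
  @crd_conj R 7 7 isT,
  @crd_one R 7 0 isT, @crd_one R 7 1 isT, @crd_one R 7 2 isT,
  @crd_one R 7 3 isT, @crd_one R 7 4 isT, @crd_one R 7 5 isT,
  @crd_one R 7 6 isT, @crd_one R 7 7 isT, dot8).

Lemma omul_linr x : linear (omul x).
Proof. by move=> c y z; apply: crd8P; rewrite !crd8E; ring. Qed.

Lemma omul_linl y : linear ((@omul R)^~ y).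
Proof. by move=> c x z; apply: crd8P; rewrite !crd8E; ring. Qed.

Lemma omul_conjK x y : omul (omul x y) (fconj y) = dot y y *: x.
Proof. by apply: crd8P; rewrite !crd8E /=; ring. Qed.

Lemma oconj_mulK x y : omul (fconj x) (omul x y) = dot x x *: y.
Proof. by apply: crd8P; rewrite !crd8E /=; ring. Qed.

Lemma dot_omull x y z : dot (omul x y) z = dot y (omul (fconj x) z).
Proof. by rewrite !crd8E /=; ring. Qed.

Lemma dot_omulr x y z : dot (omul x y) z = dot x (omul z (fconj y)).
Proof. by rewrite !crd8E /=; ring. Qed.

Lemma oconj_mul x y : fconj (omul x y) = omul (fconj y) (fconj x).
Proof. by apply: crd8P; rewrite !crd8E /=; ring. Qed.

Lemma omul_composition : composition_algebra (@omul R).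
Proof.
split; first exact: omul_linr.
- exact: omul_linl.
- by move=> x; apply: crd8P; rewrite !crd8E /=; ring.
- by move=> x; apply: crd8P; rewrite !crd8E /=; ring.
- exact: omul_conjK.
- exact: oconj_mulK.
- exact: dot_omull.
- exact: dot_omulr.
- exact: oconj_mul.
Qed.

End Octonions.

(** * The two trivializations and their transition map *)

Section LastRow.
Variables (R : realType) (q n : nat).
Implicit Types (X Y : 'M[R]_(n, q.+1)) (y z : 'M[R]_(n.+1, q.+1)).

Definition init z : 'M[R]_(n, q.+1) :=
  \matrix_(i < n) row (widen_ord (leqnSn n) i) z.

(** [insub] fails exactly at the last index, whose row is x. *)
Definition append Y (x : 'rV[R]_q.+1) : 'M[R]_(n.+1, q.+1) :=
  \matrix_(i < n.+1) (if insub (i : nat) is Some j then row j Y else x).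

Lemma init_append Y x : init (append Y x) = Y.
Proof. by apply/row_matrixP => i; rewrite !rowK insubT //= => lt; congr row; apply: val_inj. Qed.

Lemma last_append Y x : row ord_max (append Y x) = x.
Proof. by rewrite rowK insubF //= ltnn. Qed.

Lemma eq_init_last y z : init y = init z -> row ord_max y = row ord_max z -> y = z.
Proof.
move=> yz0 yz1; apply/row_matrixP => i; case: (ltngtP i n) => [lt||/eqP i_n].
- have /(congr1 (row (Ordinal lt))) := yz0; rewrite !rowK.
  by rewrite (_ : widen_ord _ _ = i) //; apply: val_inj.
- by rewrite ltnNge -ltnS ltn_ord.
- by rewrite (_ : i = ord_max) //; apply/eqP.
Qed.

Lemma init_linear : linear init.
Proof. by move=> c y z; apply/matrixP => i j; rewrite !mxE. Qed.

Lemma dot_rows a b (Z T : 'M[R]_(a, b)) :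
  dot Z T = \sum_i dot (row i Z) (row i T).
Proof.
by apply: eq_bigr => i _; rewrite /dot big_ord1; apply: eq_bigr => j _; rewrite !mxE.
Qed.

Lemma dot_init_last y z :
  dot y z = dot (init y) (init z) + dot (row ord_max y) (row ord_max z).
Proof.
rewrite dot_rows big_ord_recr /= [in RHS]dot_rows; congr (_ + _).
by apply: eq_bigr => i _; rewrite !rowK.
Qed.

End LastRow.

Section Trivialization.
Variables (R : realType) (q n p : nat).
Variable mul : 'rV[R]_q.+1 -> 'rV[R]_q.+1 -> 'rV[R]_q.+1.
Hypothesis mulP : composition_algebra mul.
Implicit Types (c x : 'rV[R]_q.+1) (X W : 'M[R]_(n, q.+1)).
Implicit Types (y z Y : 'M[R]_(n.+1, q.+1)).

Local Notation herm := (herm mul p).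
Local Notation star := (star mul p).

Lemma hermE X W : herm X W = \sum_(i < n) (if (i < p)%N
  then mul (row i X) (fconj (row i W)) else mul (row i W) (fconj (row i X))).
Proof.
rewrite (bigID (fun i : 'I_n => (i < p)%N)) /=; congr (_ + _).
  by apply: eq_bigr => i ->.
by apply: eq_big => [i|i]; rewrite leqNgt // => /negbTE ->.
Qed.

Lemma herm_linear W : linear (herm^~ W).
Proof.
move=> c X X'; rewrite !hermE scaler_sumr -big_split; apply: eq_bigr => i _ /=.
rewrite linearP /=; case: ifP => _; first exact: mul_linl mulP _ _ _ _.
by rewrite fconj_linear (mul_linr mulP).
Qed.

Lemma hermBl X X' W : herm (X - X') W = herm X W - herm X' W.
Proof. exact: linB (herm_linear W) X X'. Qed.

Lemma hermNr X W : herm X (- W) = - herm X W.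
Proof.
rewrite !hermE -sumrN; apply: eq_bigr => i _; rewrite linearN /=.
by rewrite (linN (@fconj_linear R q)) (fmulNl mulP) (fmulNr mulP); case: ifP.
Qed.

Lemma star_linear W : linear (star^~ W).
Proof.
move=> a c x; apply/row_matrixP => i; rewrite linearP /= !rowK.
case: ifP => _; first exact: mul_linl mulP _ _ _ _.
by rewrite fconj_linear (mul_linl mulP).
Qed.

Lemma starDl c x W : star (c + x) W = star c W + star x W.
Proof. exact: linD (star_linear W) c x. Qed.
Lemma starNl c W : star (- c) W = - star c W.
Proof. exact: linN (star_linear W) c. Qed.
Lemma starZl a c W : star (a *: c) W = a *: star c W.
Proof. exact: linZ (star_linear W) a c. Qed.

Lemma starNr c W : star c (- W) = - star c W.
Proof.
apply/row_matrixP => i; rewrite linearN /= !rowK linearN /= !(fmulNr mulP).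
by case: ifP.
Qed.

Lemma star1 W : star fone W = W.
Proof.
by apply/row_matrixP => i; rewrite rowK fconj1 (mul_1l mulP) if_same.
Qed.

(** Each row contributes |w|^2 c: for the first kind as (c w) conj(w), for the second as w (conj(w)
    c). The conjugation in [star] is what makes the second case work. *)
Lemma herm_star c W : herm (star c W) W = dot W W *: c.
Proof.
rewrite hermE dot_rows scaler_suml; apply: eq_bigr => i _; rewrite rowK.
case: ifP => [->|->]; first exact: mul_conjK mulP _ _.
rewrite (conj_mul mulP) fconjK -{1}[row i W]fconjK (conj_mulK mulP).
by rewrite dot_fconj.
Qed.

(** Row by row, multiplication by w is adjoint to multiplication by conj(w); hence c |-> c * W is
    the adjoint of X |-> <X, W>_p. *)
Lemma dot_star X W c : dot X (star c W) = dot (herm X W) c.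
Proof.
rewrite dotC dot_rows hermE dot_suml; apply: eq_bigr => i _; rewrite rowK.
case: (i < p)%N; first by rewrite (dot_mulr mulP) dotC.
by rewrite (dot_mull mulP) fconjK [RHS]dotC -(dot_mulr mulP) dotC.
Qed.

Definition std_fiber z Y : Prop :=
  herm (init Y) (init z) + mul (row ord_max Y) (fconj (row ord_max z)) = 0.

Definition pole_shift z : 'rV[R]_q.+1 := fone + row ord_max z.

Definition triv z X : 'M[R]_(n.+1, q.+1) :=
  let a := pole_shift z in
  let ha := (dot a a)^-1 *: mul (herm X (init z)) a in
  append (X - star ha (init z)) (- mul ha a).

Definition triv_inv z Y : 'M[R]_(n, q.+1) :=
  let a := pole_shift z in
  init Y - star ((dot a a)^-1 *: mul (row ord_max Y) (fconj a)) (init z).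

Lemma triv_linear z : linear (triv z).
Proof.
move=> c X X'; rewrite /triv; set a := pole_shift z; set nu' := _^-1.
have hE : nu' *: mul (herm (c *: X + X') (init z)) a =
    c *: (nu' *: mul (herm X (init z)) a) + nu' *: mul (herm X' (init z)) a.
  by rewrite herm_linear (mul_linl mulP) scalerDr !scalerA mulrC.
rewrite hE; apply: eq_init_last.
  by rewrite init_linear !init_append star_linear opprD scalerBr addrACA.
by rewrite [RHS]linearP /= !last_append (mul_linl mulP) opprD scalerN.
Qed.

Lemma triv_inv_linear z : linear (triv_inv z).
Proof.
move=> c Y Y'; rewrite /triv_inv; set a := pole_shift z.
rewrite init_linear linearP (mul_linl mulP) (scalerDr (_^-1)) scalerA mulrC.
by rewrite -scalerA star_linear opprD scalerBr addrACA.
Qed.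

Section OverThePoint.
Variable z : 'M[R]_(n.+1, q.+1).
Hypothesis z1 : dot z z = 1.
Let a := pole_shift z.
Let nu := dot a a.
Hypothesis nu_neq0 : nu != 0.
Let W := init z.
Let zk := row ord_max z.
Let r := zk 0 ord0.

Lemma pole_shift_re : a 0 ord0 = 1 + r.
Proof. by rewrite /a /r /zk /pole_shift !mxE !eqxx. Qed.

Lemma dot_last : dot zk zk = nu - 1 - 2 * r.
Proof.
rewrite /nu /a /pole_shift dot_sqrD -/zk (dotC fone zk) !dot_fone [fone _ _]mxE !eqxx.
by rewrite -/r /=; ring.
Qed.

Lemma dot_init : dot W W = 2 + 2 * r - nu.
Proof.
have := dot_init_last z z; rewrite z1 -/W -/zk dot_last => e.
by rewrite -[dot W W](addrK (nu - 1 - 2 * r)) -e; ring.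
Qed.

Lemma conj_last : fconj zk = fconj a - fone.
Proof.
by rewrite /a /pole_shift (linD (@fconj_linear R q)) fconj1 addrC addKr.
Qed.

Lemma mul_shift2 x : mul (mul x a) a = (2 * (1 + r)) *: mul x a - nu *: x.
Proof. by rewrite (mul_mul mulP) pole_shift_re. Qed.

Lemma triv_fiber X : std_fiber z (triv z X).
Proof.
rewrite /std_fiber /triv init_append last_append -/a -/nu -/W -/zk.
rewrite hermBl herm_star conj_last (fmulBr mulP) (mul_1r mulP).
rewrite (fmulNl mulP) !(fmulZl mulP) (mul_conjK mulP) -/nu mul_shift2 dot_init.
set h := herm X W; set g := mul h a.
by apply/rowP => j; rewrite !mxE; field.
Qed.

Lemma trivK X : triv_inv z (triv z X) = X.
Proof.
rewrite /triv_inv /triv init_append last_append -/a -/nu -/W.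
rewrite (fmulNl mulP) !(fmulZl mulP).
rewrite (mul_conjK mulP) -/nu.
by rewrite scalerN starNl opprK (scalerA _ nu) mulVf // scale1r subrK.
Qed.

Lemma triv_invK Y : std_fiber z Y -> triv z (triv_inv z Y) = Y.
Proof.
rewrite /std_fiber -/W -/zk => /eqP; rewrite addr_eq0 => /eqP hE.
set y := row ord_max Y in hE.
(* With y = - g a and h a = |a|^2 g, both sides are |a|^2 g. *)
have ha : mul (herm (triv_inv z Y) W) a = - mul y (fconj a).
  rewrite /triv_inv hermBl herm_star -/a -/nu -/W -/y hE dot_init.
  have e : mul (mul y (fconj zk)) a = mul y (fconj zk) + (nu - 1 - 2 * r) *: y.
    rewrite -dot_last -[a]/(fone + zk) (fmulDr mulP) (mul_1r mulP).
    by rewrite -{3}[zk]fconjK (mul_conjK mulP) dot_fconj.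
  have e2 : mul (mul y (fconj a)) a = nu *: y.
    by rewrite -{2}[a]fconjK (mul_conjK mulP) dot_fconj.
  rewrite (fmulBl mulP) (fmulNl mulP) e !(fmulZl mulP) e2.
  rewrite conj_last (fmulBr mulP) (mul_1r mulP).
  by apply/rowP => j; rewrite !mxE; field.
rewrite /triv -/W -/a ha; apply: eq_init_last.
  by rewrite init_append scalerN starNl opprK /triv_inv -/a -/nu -/W -/y subrK.
rewrite last_append -/nu scalerN (fmulNl mulP) opprK (fmulZl mulP).
have -> : mul (mul y (fconj a)) a = nu *: y.
  by rewrite -{2}[a]fconjK (mul_conjK mulP) dot_fconj.
by rewrite scalerA mulVf // scale1r.
Qed.

(** By polarization only norms matter. With g = (h a) / |a|^2 the norm changes by - 2 <h, g> +
    (|W|^2 + |a|^2) |g|^2, which vanishes because |W|^2 + |a|^2 = 2 Re(a) and <h, h a> = Re(a)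
    |h|^2. *)
Lemma triv_dot X X' : dot (triv z X) (triv z X') = dot X X'.
Proof.
apply: (isometry_polar (triv_linear z)) => {X'}X.
rewrite dot_init_last /triv init_append last_append -/a -/nu -/W.
set h := herm X W.
rewrite dotNl dotNr opprK (dot_mul mulP) -/nu.
rewrite dotBl !dotBr (dotC _ X) dot_star -/h.
have -> c : dot (star c W) (star c W) = (2 + 2 * r - nu) * dot c c.
  by rewrite dot_star herm_star dot_init dotZl.
rewrite !dotZl !dotZr (dot_mul mulP) -/nu (dot_mul_self mulP) pole_shift_re.
by field.
Qed.

End OverThePoint.

End Trivialization.

(** * Determinants of linear isometries of matrix spaces *)

Section LinearIsometry.
Variables (R : realType) (r s : nat).
Variable f : 'M[R]_(r, s) -> 'M[R]_(r, s).
Hypothesis f_lin : linear f.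

Lemma mxvec_lin_mx X : mxvec (f X) = mxvec X *m lin_mx f.
Proof. by have [g ->] := linear_packed f_lin; rewrite mul_vec_lin. Qed.

Lemma mxvecP (A B : 'M[R]_(r * s)) :
  (forall X : 'M[R]_(r, s), mxvec X *m A = mxvec X *m B) -> A = B.
Proof.
move=> e; apply/row_matrixP => i; rewrite !rowE.
by rewrite -[delta_mx 0 i]vec_mxK e.
Qed.

(** In the basis of matrix units, [dot] is the standard scalar product, so the matrix of f is
    orthogonal. *)
Lemma det_lin_isometry : (forall X Y, dot (f X) (f Y) = dot X Y) ->
  \det (lin_mx f) ^+ 2 = 1.
Proof.
move=> f_iso; suff e : lin_mx f *m (lin_mx f)^T = 1%:M.
  by rewrite expr2 -{2}det_tr -det_mulmx e det1.
apply: mxvecP => X; apply/rowP => i; rewrite mulmx1.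
have dotv (U V : 'M[R]_(r, s)) : (mxvec U *m (mxvec V)^T) 0 0 = dot U V.
  rewrite mxE (reindex _ (curry_mxvec_bij r s)) /dot pair_bigA /=.
  by apply: eq_bigr => -[i' j'] _; rewrite /= !mxE !mxvecE.
have cE (v : 'rV[R]_(r * s)) : v 0 i = (v *m (delta_mx 0 i : 'rV_(r * s))^T) 0 0.
  by rewrite trmx_delta -colE !mxE.
rewrite [LHS]cE [RHS]cE mulmxA -mxvec_lin_mx -mulmxA -trmx_mul.
by rewrite -[delta_mx 0 i]vec_mxK -mxvec_lin_mx !dotv f_iso.
Qed.

End LinearIsometry.

(* The determinant is both a square and a sign. *)
Lemma special_orthogonal_sqr (R : realType) (r s : nat)
    (f g : 'M[R]_(r, s) -> 'M[R]_(r, s)) :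
  linear f -> linear g -> (forall X, f X = g (g X)) ->
  (forall X Y, dot (f X) (f Y) = dot X Y) -> special_orthogonal f.
Proof.
move=> f_lin g_lin fE f_iso; split=> //.
have e : lin_mx f = lin_mx g *m lin_mx g.
  by apply: mxvecP => X; rewrite -mxvec_lin_mx // fE !mxvec_lin_mx // mulmxA.
have := det_lin_isometry f_lin f_iso.
rewrite e det_mulmx -expr2 => /eqP.
rewrite sqrf_eq1 => /orP[/eqP //|/eqP e1].
have := sqr_ge0 (\det (lin_mx g)).
by rewrite e1 oppr_ge0 ler10.
Qed.

(** * The transition map over the equator *)

Section CharMap.
Variables (R : realType) (q n p : nat).
Variable mul : 'rV[R]_q.+1 -> 'rV[R]_q.+1 -> 'rV[R]_q.+1.
Hypothesis mulP : composition_algebra mul.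
Implicit Types (c x : 'rV[R]_q.+1) (X : 'M[R]_(n, q.+1)).
Implicit Types (y z Y : 'M[R]_(n.+1, q.+1)).

(** The fibre equation is odd in z, so opposite points have the same fibre. *)
Lemma std_fiberN z Y : std_fiber p mul (- z) Y <-> std_fiber p mul z Y.
Proof.
rewrite /std_fiber (linN (@init_linear R q n)) linearN /=.
rewrite (linN (@fconj_linear R q)) (hermNr p mulP) (fmulNr mulP) -opprD.
by split=> /eqP; [rewrite oppr_eq0 => /eqP | move/eqP->; rewrite oppr0].
Qed.

Variable z : 'M[R]_(n.+1, q.+1).
Hypothesis z1 : dot z z = 1.
Let zk := row ord_max z.
Hypothesis zk_im : zk 0 ord0 = 0.
Let a := pole_shift z.
Let nu := dot a a.
Let W := init z.

Lemma equator_nu : nu = 1 + dot zk zk.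
Proof. by rewrite (dot_last z) -/zk -/a -/nu zk_im; ring. Qed.

Lemma equator_nu_gt0 : 0 < nu.
Proof. by rewrite equator_nu ltr_pwDl // dot_ge0. Qed.

Let nu_neq0 : nu != 0. Proof. by rewrite gt_eqF // equator_nu_gt0. Qed.

Lemma equator_shiftN : pole_shift (- z) = fconj a.
Proof.
rewrite /pole_shift linearN /= -/zk fconjE pole_shift_re -/zk zk_im.
by apply/rowP => j; rewrite !mxE; ring.
Qed.

Lemma equator_nuN : dot (pole_shift (- z)) (pole_shift (- z)) = nu.
Proof. by rewrite equator_shiftN dot_fconj. Qed.

Let mul_conj2 x : mul (mul x (fconj a)) (fconj a) =
  2 *: mul x (fconj a) - nu *: x.
Proof.
rewrite (mul_mul mulP) dot_fconj -/nu mxE eqxx /= pole_shift_re.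
by rewrite -/zk zk_im addr0 mulr1.
Qed.

(** Over the equator z_k is imaginary and the shift at - z is b = conj(a). The composite subtracts
    ((h b) / nu + (((h b) b) b) / nu^2) * W; the quadratic equation of b, of trace 2 and norm nu,
    turns this coefficient into 2 ((h b) b) / nu^2, and b / nu is the inverse of a. *)
Lemma char_mapE X : char_map mul p z X = triv_inv p mul z (triv p mul (- z) X).
Proof.
rewrite /char_map /triv_inv /triv equator_nuN equator_shiftN.
rewrite init_append last_append (linN (@init_linear R q n)) -/W -/zk -/a -/nu.
rewrite (hermNr p mulP) (fmulNl mulP) scalerN (starNl p mulP) (starNr p mulP).
rewrite opprK !(fmulNl mulP) opprK -addrA -opprD -(starDl p mulP).
rewrite -(starZl p mulP); congr (_ - star _ _ _ _).
rewrite (mul_sqr mulP) /falg_inv -/a -/nu !(fmulZr mulP) !(fmulZl mulP).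
rewrite !(mul_conj2, fmulBl mulP, fmulZl mulP).
rewrite -/(init z) -/W; move: (herm mul p X W) => h.
move: (mul h (fconj a)) (nu) nu_neq0 => g nu' nu'_neq0.
by apply/rowP => j; rewrite !mxE; field.
Qed.

(** This relation between two isometric trivializations of one fibre is what makes the explicit
    formula an isometry. *)
Lemma triv_char_map X : triv p mul z (char_map mul p z X) = triv p mul (- z) X.
Proof.
have zN1 : dot (- z) (- z) = 1 by rewrite dotNl dotNr opprK.
have nuN_neq0 : dot (pole_shift (- z)) (pole_shift (- z)) != 0.
  by rewrite equator_nuN.
have /std_fiberN fibN := triv_fiber p mulP zN1 nuN_neq0 X.
rewrite char_mapE.
exact: (triv_invK mulP z1 nu_neq0 fibN).
Qed.

Lemma char_map_linear : linear (char_map mul p z).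
Proof.
move=> c X X'; rewrite !char_mapE -(triv_inv_linear p mulP).
by rewrite -(triv_linear p mulP).
Qed.

Lemma char_map_dot X X' :
  dot (char_map mul p z X) (char_map mul p z X') = dot X X'.
Proof.
rewrite -(triv_dot p mulP z1 nu_neq0) !triv_char_map triv_dot //.
  by rewrite dotNl dotNr opprK.
by rewrite equator_nuN.
Qed.

Lemma imaginary_polar : (0 < q)%N -> exists t iota,
  [/\ 0 <= t, dot iota iota = 1, iota 0 ord0 = 0 & zk = t *: iota].
Proof.
move=> q_gt0; have [zk0|zk0] := eqVneq zk 0.
  (* For z_k = 0 any imaginary unit will do; e_1 is taken. *)
  exists 0, (funit R (Ordinal q_gt0)).
  by rewrite scale0r dot_delta !mxE !eqxx.
have t0 : 0 < Num.sqrt (dot zk zk) by rewrite sqrtr_gt0 dot_gt0.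
exists (Num.sqrt (dot zk zk)), ((Num.sqrt (dot zk zk))^-1 *: zk); split.
- exact: ltW.
- rewrite dotZl dotZr mulrA -{3}(sqr_sqrtr (dot_ge0 zk)) expr2.
  by field; rewrite gt_eqF.
- by rewrite mxE zk_im mulr0.
- by rewrite scalerA divff ?scale1r // gt_eqF.
Qed.

(* Write z_k = t iota with iota^2 = -1. On the span of the vectors x * W the
   map [char_map z] is the right multiplication by -((1 - z_k)/(1 + z_k))^2, of
   which the root iota (1 - z_k)/(1 + z_k) is taken; c is chosen for the square
   root of [char_map z] to be X |-> X - (<X,W> c) * W. *)
Lemma char_map_SO : (0 < q)%N -> special_orthogonal (char_map mul p z).
Proof.
move=> /imaginary_polar[t [iota [t_ge0 iota1 iota_im zkE]]].
have t1 : 1 + t != 0 by rewrite gt_eqF // ltr_pwDl.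
have nuE : nu = 1 + t ^+ 2.
  by rewrite equator_nu zkE dotZl dotZr iota1 mulr1.
have nut : 1 + t ^+ 2 != 0 by rewrite -nuE.
have mul_iota2 x : mul (mul x iota) iota = - x.
  by rewrite (mul_mul mulP) iota1 iota_im mulr0 scale0r sub0r scale1r.
(* This solves 1 - |W|^2 c = iota (1 - z_k) / (1 + z_k), where |W|^2 = 1 - t^2. The factor 1 - t has
   been cancelled, so that c is also defined when W = 0; t >= 0 keeps 1 + t nonzero. *)
pose c := nu^-1 *: (((1 - t) / (1 + t)) *: fone - iota).
pose rho X := X - star mul p (mul (herm mul p X W) c) W.
have rho_lin : linear rho.
  move=> b X X'; rewrite /rho (herm_linear p mulP) (mul_linl mulP).
  by rewrite (star_linear p mulP) opprD scalerBr addrACA.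
apply: (special_orthogonal_sqr char_map_linear rho_lin _ char_map_dot) => X.
rewrite {1}/rho (hermBl p mulP) (herm_star p mulP) {1}/rho.
set h := herm mul p X W.
rewrite -addrA -opprD -(starDl p mulP) /char_map -/zk -/W -/h.
rewrite -(starZl p mulP); congr (_ - star _ _ _ _).
rewrite (mul_sqr mulP) /falg_inv -/(pole_shift z) -/a -/nu.
have -> : fconj a = fone - t *: iota.
  by rewrite -equator_shiftN /pole_shift linearN /= -/zk zkE.
have -> : dot W W = 1 - t ^+ 2.
  by rewrite dot_init // -/zk zk_im -/a -/nu nuE; ring.
rewrite /c !(fmulZr mulP, fmulBr mulP, mul_1r mulP, fmulZl mulP, fmulBl mulP, mul_iota2).
rewrite nuE; move: (mul h iota) (h) => g h'.
by apply/rowP => j; rewrite !mxE; field; rewrite t1 nut.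
Qed.

End CharMap.

(** * Continuity of the trivializations *)

Section MatrixContinuity.
Local Open Scope classical_set_scope.
Variables (R : realType) (T : topologicalType) (x : T).

(** A neighbourhood of a matrix contains a product of neighbourhoods of its finitely many
    entries. *)
Lemma continuous_entries a b (f : T -> 'M[R]_(a, b)) :
  (forall i j, {for x, continuous (fun t => f t i j)}) -> {for x, continuous f}.
Proof.
move=> f_cont A [P fP sPA].
have near_all : \forall t \near x, forall ij : 'I_a * 'I_b, P ij.1 ij.2 (f t ij.1 ij.2).
  by apply: filter_forall => -[i j]; exact: f_cont (fP i j).
by apply: filterS near_all => t ft; apply: sPA => i j; exact: ft (i, j).
Qed.

Lemma continuous_entry a b (f : T -> 'M[R]_(a, b)) i j :
  {for x, continuous f} -> {for x, continuous (fun t => f t i j)}.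
Proof.
move=> f_cont; apply: (@continuous_comp _ _ _ f (fun M => M i j)) => //.
exact: coord_continuous.
Qed.

Lemma linear_entry a b c d (L : 'M[R]_(a, b) -> 'M[R]_(c, d)) (M : 'M[R]_(a, b)) i j :
  linear L -> L M i j = \sum_k \sum_l M k l * L (delta_mx k l) i j.
Proof.
move=> L_lin; rewrite {1}[M]matrix_sum_delta (lin_sum L_lin) summxE.
apply: eq_bigr => k _; rewrite (lin_sum L_lin) summxE.
by apply: eq_bigr => l _; rewrite (linZ L_lin) mxE.
Qed.

Lemma continuous_sum (I : finType) (f : I -> T -> R) :
  (forall i, {for x, continuous (f i)}) ->
  {for x, continuous (fun t => \sum_i f i t)}.
Proof.
by move=> f_cont; apply: (cvg_big add_continuous) => i _; exact: f_cont.
Qed.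

(** One statement for [mul], [herm] and [star]: the entries of a bilinear expression are polynomials
    in the entries of its arguments. *)
Lemma continuous_bilinear a b c d e g
    (B : 'M[R]_(a, b) -> 'M[R]_(c, d) -> 'M[R]_(e, g)) f1 f2 :
  (forall N, linear (B^~ N)) -> (forall M, linear (B M)) ->
  {for x, continuous f1} -> {for x, continuous f2} ->
  {for x, continuous (fun t => B (f1 t) (f2 t))}.
Proof.
move=> B_linl B_linr f1_cont f2_cont; apply: continuous_entries => i j.
have -> : (fun t => B (f1 t) (f2 t) i j) = (fun t => \sum_k \sum_l
    f1 t k l *
      \sum_k0 \sum_l0 f2 t k0 l0 * B (delta_mx k l) (delta_mx k0 l0) i j).
  apply/funext => t; rewrite (linear_entry _ _ _ (B_linl _)).
  apply: eq_bigr => k _; apply: eq_bigr => l _; congr (_ * _).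
  exact: linear_entry.
apply: continuous_sum => k; apply: continuous_sum => l; apply: cvgM.
  exact: continuous_entry.
apply: continuous_sum => k'; apply: continuous_sum => l'; apply: cvgM.
  exact: continuous_entry.
exact: cvg_cst.
Qed.

Lemma continuous_linear a b c d (L : 'M[R]_(a, b) -> 'M[R]_(c, d)) f :
  linear L -> {for x, continuous f} -> {for x, continuous (fun t => L (f t))}.
Proof.
move=> L_lin f_cont; apply: continuous_entries => i j.
have -> : (fun t => L (f t) i j) =
    (fun t => \sum_k \sum_l f t k l * L (delta_mx k l) i j).
  by apply/funext => t; exact: linear_entry.
apply: continuous_sum => k; apply: continuous_sum => l; apply: cvgM.
  exact: continuous_entry.
exact: cvg_cst.
Qed.

Lemma continuous_dot a b (f g : T -> 'M[R]_(a, b)) :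
  {for x, continuous f} -> {for x, continuous g} ->
  {for x, continuous (fun t => dot (f t) (g t))}.
Proof.
move=> f_cont g_cont; apply: continuous_sum => i; apply: continuous_sum => j.
by apply: cvgM; exact: continuous_entry.
Qed.

Lemma continuous_scale a b (c : T -> R) (f : T -> 'M[R]_(a, b)) :
  {for x, continuous c} -> {for x, continuous f} ->
  {for x, continuous (fun t => c t *: f t)}.
Proof.
move=> c_cont f_cont; apply: continuous_entries => i j.
have -> : (fun t => (c t *: f t) i j) = (fun t => c t * f t i j).
  by apply/funext => t; rewrite mxE.
by apply: cvgM => //; exact: continuous_entry.
Qed.

Lemma continuous_sub a b (f g : T -> 'M[R]_(a, b)) :
  {for x, continuous f} -> {for x, continuous g} ->
  {for x, continuous (fun t => f t - g t)}.
Proof.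
move=> f_cont g_cont; apply: continuous_entries => i j.
have -> : (fun t => (f t - g t) i j) = (fun t => f t i j - g t i j).
  by apply/funext => t; rewrite !mxE.
by apply: cvgB; exact: continuous_entry.
Qed.

Lemma continuous_append n q (f : T -> 'M[R]_(n, q.+1)) (g : T -> 'rV[R]_q.+1) :
  {for x, continuous f} -> {for x, continuous g} ->
  {for x, continuous (fun t => append (f t) (g t))}.
Proof.
move=> f_cont g_cont; apply: continuous_entries => i j.
rewrite /append; have [k _ ki|i_n] := @insubP _ _ 'I_n (i : nat).
  have -> : (fun t => (\matrix_(i < n.+1) if insub (i : nat) is Some j
      then row j (f t) else g t) i j) = (fun t => f t k j).
    by apply/funext => t; rewrite mxE -ki valK mxE.
  exact: continuous_entry.
have -> : (fun t => (\matrix_(i < n.+1) if insub (i : nat) is Some j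
    then row j (f t) else g t) i j) = (fun t => g t 0 j).
  by apply/funext => t; rewrite mxE insubN.
exact: continuous_entry.
Qed.

Section Algebra.
Variables (q n p : nat) (mul : 'rV[R]_q.+1 -> 'rV[R]_q.+1 -> 'rV[R]_q.+1).
Hypothesis mulP : composition_algebra mul.

Lemma herm_linr (X : 'M[R]_(n, q.+1)) : linear (herm mul p X).
Proof.
move=> c W W'; rewrite !hermE scaler_sumr -big_split; apply: eq_bigr => i _ /=.
rewrite linearP /=; case: ifP => _; last exact: mul_linl mulP _ _ _ _.
by rewrite fconj_linear (mul_linr mulP).
Qed.

Lemma star_linr c : linear (@star R q n mul p c).
Proof.
move=> b W W'; apply/row_matrixP => i; rewrite linearP /= !rowK linearP /=.
by case: ifP => _; rewrite (mul_linr mulP).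
Qed.

Variables (z : T -> 'M[R]_(n.+1, q.+1)) (X : T -> 'M[R]_(n, q.+1)).
Variable Y : T -> 'M[R]_(n.+1, q.+1).
Hypothesis z_cont : {for x, continuous z}.
Hypothesis nu_neq0 : dot (pole_shift (z x)) (pole_shift (z x)) != 0.

Lemma continuous_shift : {for x, continuous (fun t => pole_shift (z t))}.
Proof.
apply: continuous_entries => i j; rewrite /pole_shift.
have -> : (fun t => (fone + row ord_max (z t)) i j) =
    (fun t => @fone R q i j + z t ord_max j).
  by apply/funext => t; rewrite !mxE.
by apply: cvgD; [exact: cvg_cst | exact: continuous_entry].
Qed.

Lemma continuous_shift_inv : {for x, continuous
  (fun t => (dot (pole_shift (z t)) (pole_shift (z t)))^-1)}.
Proof. by apply: cvgV => //; apply: continuous_dot; exact: continuous_shift. Qed.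

Lemma continuous_init : {for x, continuous (fun t => init (z t))}.
Proof. by apply: continuous_linear => //; exact: init_linear. Qed.

Lemma continuous_triv : {for x, continuous X} ->
  {for x, continuous (fun t => triv p mul (z t) (X t))}.
Proof.
move=> X_cont.
have ha_cont : {for x, continuous (fun t =>
    (dot (pole_shift (z t)) (pole_shift (z t)))^-1 *:
      mul (herm mul p (X t) (init (z t))) (pole_shift (z t)))}.
  apply: continuous_scale; first exact: continuous_shift_inv.
  apply: continuous_bilinear; [exact: mul_linl mulP|exact: mul_linr mulP| |
    exact: continuous_shift].
  apply: continuous_bilinear; [exact: herm_linear|exact: herm_linr|
    exact: X_cont|exact: continuous_init].
apply: continuous_append.
  apply: continuous_sub; first exact: X_cont.
  apply: continuous_bilinear; [exact: star_linear|exact: star_linr|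
    exact: ha_cont|exact: continuous_init].
apply: (@continuous_linear _ _ _ _ (fun v => - v)).
  by move=> c v w; rewrite opprD scalerN.
apply: continuous_bilinear; [exact: mul_linl mulP|exact: mul_linr mulP|
  exact: ha_cont|exact: continuous_shift].
Qed.

Lemma continuous_triv_inv : {for x, continuous Y} ->
  {for x, continuous (fun t => triv_inv p mul (z t) (Y t))}.
Proof.
move=> Y_cont; apply: continuous_sub.
  by apply: continuous_linear => //; exact: init_linear.
apply: continuous_bilinear; [exact: star_linear|exact: star_linr| |
  exact: continuous_init].
apply: continuous_scale; first exact: continuous_shift_inv.
apply: continuous_bilinear; [exact: mul_linl mulP|exact: mul_linr mulP| | ].
  by apply: continuous_linear => // c v w; rewrite linearP.
apply: continuous_linear; [exact: fconj_linear|exact: continuous_shift].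
Qed.

End Algebra.

End MatrixContinuity.

Lemma continuous_pair (S T U : topologicalType) (x : T) (f : T -> S) (g : T -> U) :
  {for x, continuous f} -> {for x, continuous g} ->
  {for x, continuous (fun t => (f t, g t))}.
Proof. by move=> f_cont g_cont; exact: cvg_pair f_cont g_cont. Qed.

(** * The fibres of eta and its characteristic map *)

Section CharacteristicMap.
Local Open Scope classical_set_scope.
Variables (R : realType) (q n l p : nat).
Variable mul : 'rV[R]_q.+1 -> 'rV[R]_q.+1 -> 'rV[R]_q.+1.
Hypothesis mulP : composition_algebra mul.
Variables (E : 'I_q -> 'M[R]_l) (Phi : 'cV[R]_l -> 'M[R]_(n.+1, q.+1)).
Hypothesis PhiP : std_identification mul p E Phi.

Let Phi_lin : linear Phi. Proof. by case: PhiP. Qed.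
Let Phi_dot x y : dot (Phi x) (Phi y) = dot x y. Proof. by case: PhiP. Qed.

Lemma fconj_unit a : fconj (funit R a) = - funit R a :> 'rV_q.+1.
Proof. by rewrite fconjE mxE eqxx /= mulr0 scale0r sub0r. Qed.

(** Its scalar product with c in F is <init Y, c * init z> + <y, c z_k>, where y is the last row of
    Y. For c = 1 this is <Y, z>, and for c = e_a it is <Y, E_a z>: the conjugation in [star] gives
    the sign that E_a carries on the rows from p on, the last one excepted. *)
Definition fiber_eq (z Y : 'M[R]_(n.+1, q.+1)) : 'rV[R]_q.+1 :=
  herm mul p (init Y) (init z) + mul (row ord_max Y) (fconj (row ord_max z)).

Lemma dot_fiber_eq z Y : dot Y z = fiber_eq z Y 0 ord0.
Proof.
rewrite -dot_fone dotDl -(dot_star p mulP) (star1 p mulP) dot_init_last.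
by rewrite (dot_mulr mulP) fconjK (mul_1l mulP).
Qed.

Lemma dot_std_E z Y a : dot Y (std_E mul p a z) = fiber_eq z Y 0 (lift ord0 a).
Proof.
rewrite -dot_delta dotDl -/(funit R a) -(dot_star p mulP) dot_init_last.
congr (_ + _).
  congr dot; apply/row_matrixP => i; rewrite !rowK fconj_unit (fmulNl mulP).
  rewrite (_ : (_ == ord_max) = false) ?orbF //.
  by apply/negbTE; rewrite -val_eqE /= neq_ltn ltn_ord.
rewrite !rowK eqxx orbT [RHS]dotC (dotC _ (mul _ _)).
by rewrite (dot_mulr mulP).
Qed.

Lemma eta_fiberE x Y : eta_fiber E x Y <-> std_fiber p mul (Phi x) (Phi Y).
Proof.
have PhiE a v : Phi (E a *m v) = std_E mul p a (Phi v) by case: PhiP.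
split=> [fibY|fibY V].
  apply/rowP => j; rewrite [RHS]mxE -/(fiber_eq _ _).
  case: (unliftP ord0 j) => [a|] ->; rewrite -?dot_fiber_eq -?dot_std_E.
    rewrite -PhiE Phi_dot fibY // memv_span // inE.
    by apply/orP; right; apply/mapP; exists a; rewrite ?mem_enum.
  by rewrite Phi_dot fibY // memv_span // inE eqxx.
rewrite /std_fiber -/(fiber_eq _ _) in fibY.
move=> /coord_span ->; rewrite dot_sumr big1 // => i _; rewrite dotZr.
have: (x :: [seq E a *m x | a : 'I_q])`_i \in x :: [seq E a *m x | a : 'I_q].
  by apply: mem_nth; rewrite /= size_map -cardE ltn_ord.
rewrite inE /= => /predU1P[->|/mapP[a _ ->]].
  by rewrite -Phi_dot dot_fiber_eq fibY mxE mulr0.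
by rewrite -Phi_dot PhiE dot_std_E fibY mxE mulr0.
Qed.

Variable Psi : 'M[R]_(n.+1, q.+1) -> 'cV[R]_l.
Hypothesis PhiK : cancel Phi Psi.
Hypothesis PsiK : cancel Psi Phi.

Let Psi_lin : linear Psi.
Proof. by move=> c y z; apply: (can_inj PhiK); rewrite Phi_lin !PsiK. Qed.

(** The map f is left free in order to treat both poles at once: it will be Phi and - Phi. *)
Lemma trivialization (U : set 'cV[R]_l) (f : 'cV[R]_l -> 'M[R]_(n.+1, q.+1)) :
  linear f -> (forall z, U z -> dot (f z) (f z) = 1) ->
  (forall z, U z -> dot (pole_shift (f z)) (pole_shift (f z)) != 0) ->
  (forall z Y, eta_fiber E z Y <-> std_fiber p mul (f z) (Phi Y)) ->
  isometric_trivialization U (eta_fiber E)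
    (fun u => (u.1, Psi (triv p mul (f u.1) u.2)))
    (fun v => (v.1, triv_inv p mul (f v.1) (Phi v.2))).
Proof.
move=> f_lin f1 f_neq0 fib; split; first split.
- apply: continuous_in_subspaceT => u; rewrite inE => -[/= Uu _].
  have f_cont : {for u, continuous (fun t : 'cV[R]_l * 'M[R]_(n, q.+1) => f t.1)}.
    by apply: (continuous_linear f_lin); exact: cvg_fst.
  have snd_cont : {for u, continuous (fun t : 'cV[R]_l * 'M[R]_(n, q.+1) => t.2)}.
    exact: cvg_snd.
  apply: continuous_pair; first exact: cvg_fst.
  apply: (continuous_linear Psi_lin).
  exact: (@continuous_triv R _ u q n p mul mulP _ _ f_cont (f_neq0 _ Uu) snd_cont).
- apply: continuous_in_subspaceT => u; rewrite inE => -[/= Uu _].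
  have f_cont : {for u, continuous (fun t : 'cV[R]_l * 'cV[R]_l => f t.1)}.
    by apply: (continuous_linear f_lin); exact: cvg_fst.
  have Phi_cont : {for u, continuous (fun t : 'cV[R]_l * 'cV[R]_l => Phi t.2)}.
    by apply: (continuous_linear Phi_lin); exact: cvg_snd.
  apply: continuous_pair; first exact: cvg_fst.
  exact: (@continuous_triv_inv R _ u q n p mul mulP _ _ f_cont (f_neq0 _ Uu) Phi_cont).
- move=> [z X] [/= Uz _].
  have z1 := f1 z Uz; have z0 := f_neq0 z Uz.
  have fibX : eta_fiber E z (Psi (triv p mul (f z) X)).
    by apply/fib; rewrite PsiK; exact: (triv_fiber p mulP z1 z0 X).
  by split; [split | rewrite PsiK (trivK p mulP z0)].
- move=> [z Y] [/= Uz /fib fibY]; split=> //.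
  by rewrite (triv_invK mulP (f1 z Uz) (f_neq0 z Uz) fibY) PhiK.
- by [].
- by move=> z Uz c X X'; rewrite /= (triv_linear p mulP) Psi_lin.
- move=> z X X' Uz /=; rewrite -Phi_dot !PsiK.
  exact: (triv_dot p mulP (f1 z Uz) (f_neq0 z Uz)).
Qed.

(** If 1 + z_k = 0, the last row already has norm 1, so the other rows vanish and z is the south
    pole. *)
Lemma pole_shift_neq0 (z : 'M[R]_(n.+1, q.+1)) :
  dot z z = 1 -> z != - north_pole -> dot (pole_shift z) (pole_shift z) != 0.
Proof.
move=> z1 /eqP zN; apply/eqP => /eqP; rewrite dot_eq0 /pole_shift addrC addr_eq0 => /eqP zk.
apply: zN; apply: eq_init_last; last first.
  rewrite zk linearN /=; congr (- _); apply/rowP => j.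
  by rewrite !mxE !eqxx.
have := dot_init_last z z; rewrite z1 zk dotNl dotNr opprK dot_fone mxE !eqxx /=.
move=> e; have /eqP : dot (init z) (init z) = 0 by lra.
rewrite dot_eq0 => /eqP ->.
apply/matrixP => i j; rewrite !mxE (_ : (_ == _) = false) ?oppr0 //.
by apply/negbTE; rewrite -val_eqE /= neq_ltn ltn_ord.
Qed.

Lemma characteristic_map_eta (N : 'cV[R]_l) : (0 < q)%N ->
  Phi N = north_pole ->
  is_characteristic_map (eta_fiber E) N (fun z => char_map mul p (Phi z)).
Proof.
move=> q_gt0 PhiN.
have eqz z : equator N z ->
    dot (Phi z) (Phi z) = 1 /\ row ord_max (Phi z) 0 ord0 = 0.
  move=> [z1 zN]; split; first by rewrite Phi_dot.
  by rewrite mxE -(dot_delta _ ord_max ord0) -/north_pole -PhiN Phi_dot.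
split=> [z /eqz[z1 z0]|]; first exact: char_map_SO.
exists (fun u => (u.1, Psi (triv p mul (Phi u.1) u.2))).
exists (fun v => (v.1, triv_inv p mul (Phi v.1) (Phi v.2))).
exists (fun u => (u.1, Psi (triv p mul (- Phi u.1) u.2))).
exists (fun v => (v.1, triv_inv p mul (- Phi v.1) (Phi v.2))).
split.
- apply: trivialization => // [z [z1 _]|z [z1 zN]|]; first by rewrite Phi_dot.
    apply: pole_shift_neq0; first by rewrite Phi_dot.
    apply/eqP => e; apply: zN.
    by apply: (can_inj PhiK); rewrite e (linN Phi_lin) PhiN.
  exact: eta_fiberE.
- apply: (trivialization (f := fun z => - Phi z)) => [|z [z1 _]|z [z1 zN]|z Y].
  + by move=> c x y; rewrite Phi_lin opprD scalerN.
  + by rewrite dotNl dotNr opprK Phi_dot.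
  + apply: pole_shift_neq0; first by rewrite dotNl dotNr opprK Phi_dot.
    apply/eqP => /oppr_inj e; apply: zN.
    by apply: (can_inj PhiK); rewrite e PhiN.
  + exact: (iff_trans (eta_fiberE z Y) (iff_sym (std_fiberN p mulP _ _))).
- move=> z X /eqz[z1 z0] /=.
  by rewrite PsiK (char_mapE p mulP z0).
Qed.

End CharacteristicMap.

(** * Orthonormal blocks and the normal form of a Clifford system *)

Section OrthonormalBlocks.
Variables (R : realType) (d n : nat) (I : Type) (T : I -> 'M[R]_n).
Variable Q : 'M[R]_(d, n) -> Prop.
Hypothesis d_gt0 : (0 < d)%N.
Hypothesis Q_comm : forall b t, Q b -> b^T *m b *m T t = T t *m (b^T *m b).
Hypothesis Q_ext : forall M : 'M[R]_n, M^T = M -> M *m M = M ->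
  (forall t, M *m T t = T t *m M) -> M != 0 ->
  exists c, [/\ Q c, c *m c^T = 1%:M & c *m M = c].

Definition orthonormal_blocks (j : nat) (b : nat -> 'M[R]_(d, n)) : Prop :=
  (forall i, (i < j)%N -> Q (b i)) /\
  (forall i k, (i < j)%N -> (k < j)%N -> b i *m (b k)^T = (i == k)%:R%:M).

(** The orthogonal projection onto what the first j blocks leave over. It commutes with all T_t,
    hence is a legitimate argument of [Q_ext], and its trace is the dimension that remains. *)
Definition complement (j : nat) (b : nat -> 'M[R]_(d, n)) : 'M[R]_n :=
  1%:M - \sum_(i < j) (b i)^T *m b i.

Lemma complement_mulr j b i : orthonormal_blocks j b -> (i < j)%N ->
  b i *m complement j b = 0.
Proof.
move=> [_ b_orth] ij; rewrite mulmxBr mulmx1 mulmx_sumr.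
rewrite (bigD1 (Ordinal ij)) //= mulmxA b_orth // eqxx mul1mx.
rewrite big1 ?addr0 ?subrr // => k; rewrite -val_eqE /= eq_sym => /negbTE ki.
by rewrite mulmxA b_orth // ki mul_scalar_mx scale0r.
Qed.

Lemma complement_sym j b : (complement j b)^T = complement j b.
Proof.
rewrite /complement linearB /= trmx1 linear_sum /=; congr (_ - _).
by apply: eq_bigr => i _; rewrite trmx_mul trmxK.
Qed.

Lemma complement_idem j b : orthonormal_blocks j b ->
  complement j b *m complement j b = complement j b.
Proof.
move=> b_orth; rewrite {1}/complement mulmxBl mul1mx mulmx_suml big1 ?subr0 //.
by move=> i _; rewrite -mulmxA complement_mulr ?mulmx0.
Qed.

Lemma complement_comm j b t : orthonormal_blocks j b ->
  complement j b *m T t = T t *m complement j b.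
Proof.
move=> [Qb _]; rewrite mulmxBl mulmxBr mul1mx mulmx1 mulmx_suml mulmx_sumr.
by congr (_ - _); apply: eq_bigr => i _; rewrite Q_comm //; exact: Qb.
Qed.

Lemma trace_complement j b : orthonormal_blocks j b ->
  \tr (complement j b) = n%:R - (j * d)%:R.
Proof.
move=> [_ b_orth]; rewrite /complement raddfB /= mxtrace1.
rewrite (big_morph _ (@mxtraceD R n) (mxtrace0 R n)).
congr (_ - _).
have tr_block (i : 'I_j) : \tr ((b i)^T *m b i) = d%:R.
  by rewrite mxtrace_mulC b_orth // eqxx mxtrace1.
under eq_bigr => i _ do rewrite tr_block.
by rewrite sumr_const card_ord -mulrnA mulnC.
Qed.

(** The trace of a symmetric idempotent matrix is its squared norm. *)
Lemma orthonormal_blocks_bound j b : orthonormal_blocks j b -> (j * d <= n)%N.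
Proof.
move=> b_orth; rewrite -(ler_nat R) -subr_ge0 -(trace_complement b_orth).
rewrite -(complement_idem b_orth) -{2}complement_sym -dotE.
exact: dot_ge0.
Qed.

Lemma orthonormal_blocks_exist : exists j b,
  [/\ (j * d)%N = n, orthonormal_blocks j b &
      \sum_(i < j) (b i)^T *m b i = 1%:M].
Proof.
(* The counter m = n + 1 - j cannot reach 0, since j blocks occupy j d <= n dimensions and d > 0. *)
suff ext m j b : (j + m)%N = n.+1 -> orthonormal_blocks j b -> exists j b,
    orthonormal_blocks j b /\ complement j b = 0.
  have [|j [b [b_orth b0]]] := ext n.+1 0%N (fun=> 0) erefl; first by [].
  exists j, b; split=> //.
    have := trace_complement b_orth; rewrite b0 mxtrace0 => /esym/eqP.
    by rewrite subr_eq0 eqr_nat => /eqP.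
  by apply/esym/eqP; rewrite -subr_eq0; apply/eqP.
elim: m j b => [|m IHm] j b jm b_orth.
  have := orthonormal_blocks_bound b_orth; rewrite leqNgt.
  by rewrite (leq_trans _ (leq_pmulr j d_gt0)) // -jm addn0.
have [b0|b_neq0] := eqVneq (complement j b) 0; first by exists j, b.
have [||t|c [Qc c1 cM]] := Q_ext _ _ _ b_neq0.
- exact: complement_sym.
- exact: complement_idem.
- exact: complement_comm.
have cb i : (i < j)%N -> c *m (b i)^T = 0.
  move=> ij; rewrite -cM -mulmxA -[complement j b]complement_sym -trmx_mul.
  by rewrite complement_mulr // trmx0 mulmx0.
apply: (IHm j.+1 (fun i => if i == j then c else b i)); first by rewrite -jm addSnnS.
case: b_orth => Qb b_orth; split=> [i|i k].
  rewrite ltnS => ij; have [//|i_neq] := eqVneq i j.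
  by apply: Qb; rewrite ltn_neqAle i_neq.
rewrite !ltnS => ij kj; have [->|i_neq] := eqVneq i j.
  have [kj'|k_neq] := eqVneq k j; first by rewrite c1 ?kj' ?eqxx.
  by rewrite cb ?raddf0 // ltn_neqAle k_neq.
have [kj'|k_neq] := eqVneq k j.
  rewrite ?kj' ?(negbTE i_neq) raddf0 -[LHS]trmxK trmx_mul trmxK cb ?trmx0 //.
  by rewrite ltn_neqAle i_neq.
by apply: b_orth; rewrite ltn_neqAle ?i_neq ?k_neq.
Qed.

End OrthonormalBlocks.

Lemma unit_row (R : realType) (n : nat) (y : 'rV[R]_n) : y != 0 ->
  exists c : R, (c *: y) *m (c *: y)^T = 1%:M.
Proof.
move=> y0; have y_gt0 : 0 < dot y y by rewrite dot_gt0.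
exists (Num.sqrt (dot y y))^-1; rewrite linearZ -scalemxAr -scalemxAl scalerA.
have -> : y *m y^T = (dot y y)%:M.
  apply/matrixP => i j; rewrite !ord1 mxE [RHS]mxE mulr1n /dot big_ord1.
  by apply: eq_bigr => k _; rewrite mxE.
rewrite -mul_scalar_mx -scalar_mxM -{3}(sqr_sqrtr (dot_ge0 y)).
by congr _%:M; field; rewrite gt_eqF // sqrtr_gt0.
Qed.

Lemma mx_double_eq0 (R : realType) (a b : nat) (B : 'M[R]_(a, b)) :
  B + B = 0 -> B = 0.
Proof.
move=> /eqP; rewrite -mulr2n -scaler_nat scaler_eq0 pnatr_eq0 orFb.
by move=> /eqP.
Qed.

Section NormalForm.
Variables (R : realType) (q l : nat) (P : 'I_q.+2 -> 'M[R]_(l + l)).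
Hypothesis P_cliff : clifford_system P.

Let P_sym i : (P i)^T = P i. Proof. by case: P_cliff. Qed.

Lemma clifford_sqr i : P i *m P i = 1%:M.
Proof.
have [_ /(_ i i)] := P_cliff; rewrite eqxx mulr1 -mulr2n => /eqP.
rewrite -scaler_nat => /eqP e; apply: (@scalerI _ _ (2%:R : R)).
  by rewrite pnatr_eq0.
by rewrite e -scalemx1.
Qed.

Lemma clifford_anticomm i j : i != j -> P i *m P j = - (P j *m P i).
Proof.
move=> /negbTE ij; have [_ /(_ i j)] := P_cliff.
by rewrite ij mulr0 raddf0 => /eqP; rewrite addr_eq0 => /eqP.
Qed.

Let P0 := P ord0.
Let P1 := P (lift ord0 ord0).

Let P10 : P1 *m P0 = - (P0 *m P1). Proof. exact: clifford_anticomm. Qed.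

(** A pair (v, v P_1) with v P_0 = v. By anticommutation v P_1 has eigenvalue -1, so on the pair P_0
    acts as diag(1, -1) and P_1 as the exchange. *)
Let adapted_pair (b : 'M[R]_(1 + 1, l + l)) :=
  dsubmx b = usubmx b *m P1 /\ usubmx b *m P0 = usubmx b.

Lemma adapted_pair_exists (M : 'M[R]_(l + l)) :
  (forall t : bool, M *m (if t then P0 else P1) = (if t then P0 else P1) *m M) ->
  M *m M = M -> M != 0 ->
  exists c, [/\ adapted_pair c, c *m c^T = 1%:M & c *m M = c].
Proof.
move=> M_comm M_idem M_neq0.
have M0 : M *m P0 = P0 *m M := M_comm true.
have M1 : M *m P1 = P1 *m M := M_comm false.
have [x [x0 xM]] : exists x : 'rV[R]_(l + l), x != 0 /\ x *m M = x.
  have [/forallP all0|] := boolP [forall i, row i M == 0].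
    by case/eqP: M_neq0; apply/row_matrixP => i; rewrite row0; exact/eqP.
  rewrite negb_forall => /existsP[i Mi]; exists (row i M); split=> //.
  by rewrite -row_mul M_idem.
(* x + x P_0 is fixed by P_0; if it vanishes, x has eigenvalue -1 and x P_1 has eigenvalue 1. *)
have [y [y0 yM yP]] : exists y : 'rV[R]_(l + l),
    [/\ y != 0, y *m M = y & y *m P0 = y].
  have [/eqP|y0] := eqVneq (x + x *m P0) 0.
    rewrite addrC addr_eq0 => /eqP xP0; exists (x *m P1); split.
    - apply/eqP => xP1; case/eqP: x0.
      by rewrite -[x]mulmx1 -(clifford_sqr (lift ord0 ord0)) mulmxA xP1 mul0mx.
    - by rewrite -mulmxA -M1 mulmxA xM.
    - by rewrite -mulmxA P10 mulmxN mulmxA xP0 mulNmx opprK.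
  exists (x + x *m P0); split=> //.
    by rewrite mulmxDl -mulmxA -M0 mulmxA xM.
  by rewrite mulmxDl -mulmxA clifford_sqr mulmx1 addrC.
have [a va] := unit_row y0; set v := a *: y in va.
have vP : v *m P0 = v by rewrite -scalemxAl yP.
have vM : v *m M = v by rewrite -scalemxAl yM.
(* v and v P_1 belong to different eigenvalues of the symmetric P_0. *)
have vP1 : v *m P1 *m v^T = 0.
  have P0v : P0 *m v^T = v^T by rewrite -{2}vP trmx_mul P_sym.
  have e : v *m P1 *m v^T = - (v *m P1 *m v^T).
    rewrite -{1}vP -[v *m P0 *m P1]mulmxA -[P0 *m P1]opprK -P10 mulmxN mulNmx.
    by rewrite mulmxA -[_ *m P0 *m v^T]mulmxA P0v.
  by apply: mx_double_eq0; rewrite {1}e addNr.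
exists (col_mx v (v *m P1)); split.
- by rewrite /adapted_pair col_mxKd col_mxKu.
- rewrite tr_col_mx mul_col_row va vP1 trmx_mul P_sym mulmxA vP1.
  by rewrite mulmxA -(mulmxA v) clifford_sqr mulmx1 va -scalar_mx_block.
- by rewrite mul_col_mx vM -mulmxA -M1 mulmxA vM.
Qed.

Lemma normal_basis_exists : exists A : 'M[R]_(l + l),
  [/\ A^T *m A = 1%:M, A *m P0 = block_mx 1%:M 0 0 (- 1%:M) *m A &
      A *m P1 = block_mx 0 1%:M 1%:M 0 *m A].
Proof.
pose T (t : bool) := if t then P0 else P1.
have bE b : adapted_pair b -> b = col_mx (usubmx b) (usubmx b *m P1).
  by move=> [<- _]; rewrite vsubmxK.
have bP0 b : adapted_pair b -> b *m P0 = block_mx 1%:M 0 0 (- 1%:M) *m b.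
  move=> bP; have [_ vP] := bP; rewrite (bE _ bP) mul_block_col mul_col_mx vP.
  by rewrite !mul1mx !mul0mx addr0 add0r mulNmx mul1mx -mulmxA P10 mulmxN mulmxA vP.
have bP1 b : adapted_pair b -> b *m P1 = block_mx 0 1%:M 1%:M 0 *m b.
  move=> bP; rewrite (bE _ bP) mul_block_col mul_col_mx.
  by rewrite !mul1mx !mul0mx addr0 add0r -mulmxA clifford_sqr mulmx1.
have Q_comm b t : adapted_pair b -> b^T *m b *m T t = T t *m (b^T *m b).
  move=> bP; have [S [S_sym bT]] : exists S, S^T = S /\ b *m T t = S *m b.
    case: t; [exists (block_mx 1%:M 0 0 (- 1%:M)) | exists (block_mx 0 1%:M 1%:M 0)];
      by rewrite tr_block_mx ?linearN /= ?trmx1 ?trmx0; split=> //; auto.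
  have T_sym : (T t)^T = T t by case: t bT => _; exact: P_sym.
  by rewrite -mulmxA bT mulmxA -[in LHS]S_sym -trmx_mul -bT trmx_mul T_sym mulmxA.
have [j [b [jE [Qb b_orth] b1]]] := @orthonormal_blocks_exist R _ _ _ T adapted_pair
  isT Q_comm (fun M _ idem comm neq0 => adapted_pair_exists comm idem neq0).
have {jE} jl : j = l.
  by apply/eqP; rewrite -(eqn_pmul2r (isT : (0 < 1 + 1)%N)) jE addnn muln2.
subst j; pose V := \matrix_(i < l) usubmx (b i).
have VP0 : V *m P0 = V.
  by apply/row_matrixP => i; rewrite row_mul !rowK; have [] := Qb i (ltn_ord i).
(* The pairs are regrouped: all first vectors, then all second ones. *)
exists (col_mx V (V *m P1)); split.
- rewrite tr_col_mx mul_row_col -b1.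
  have trV m (F : 'I_l -> 'rV[R]_m) :
      (\matrix_i F i)^T *m \matrix_i F i = \sum_i (F i)^T *m F i.
    apply/matrixP => x y; rewrite mxE summxE; apply: eq_bigr => i _.
    by rewrite [RHS]mxE big_ord1 !mxE.
  have -> : V *m P1 = \matrix_(i < l) dsubmx (b i).
    apply/row_matrixP => i; rewrite row_mul !rowK.
    by have [-> _] := Qb i (ltn_ord i).
  rewrite !trV -big_split; apply: eq_bigr => i _ /=.
  by rewrite -mul_row_col -tr_col_mx vsubmxK.
- rewrite mul_block_col mul_col_mx VP0 !mul1mx !mul0mx addr0 add0r mulNmx mul1mx.
  by rewrite -mulmxA P10 mulmxN mulmxA VP0.
- rewrite mul_block_col mul_col_mx !mul1mx !mul0mx addr0 add0r.
  by rewrite -mulmxA clifford_sqr mulmx1.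
Qed.

(** Anticommuting with P_0 kills the diagonal blocks of each further operator, and anticommuting
    with P_1 makes the other two opposite; symmetry then becomes skewness of E_a. *)
Lemma normal_form_exists : exists A E, clifford_normal_form P A E.
Proof.
have [A [AtA AP0 AP1]] := normal_basis_exists.
have AAt : A *m A^T = 1%:M by apply: mulmx1C.
pose Q i := A *m P i *m A^T.
have Q_sym i : (Q i)^T = Q i by rewrite /Q !trmx_mul trmxK P_sym mulmxA.
have Q_cliff i j : Q i *m Q j + Q j *m Q i = (2 * (i == j)%:R)%:M.
  have QQ i' j' : Q i' *m Q j' = A *m (P i' *m P j') *m A^T.
    by rewrite /Q !mulmxA -(mulmxA _ A^T A) AtA mulmx1.
  rewrite !QQ -mulmxDl -mulmxDr; case: P_cliff => _ ->.
  by rewrite mul_mx_scalar -scalemxAl AAt scalemx1.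
have Q0 : Q ord0 = block_mx 1%:M 0 0 (- 1%:M).
  by rewrite /Q AP0 -mulmxA AAt mulmx1.
have Q1 : Q (lift ord0 ord0) = block_mx 0 1%:M 1%:M 0.
  by rewrite /Q AP1 -mulmxA AAt mulmx1.
pose i_ (a : 'I_q) : 'I_q.+2 := lift ord0 (lift ord0 a).
pose E a := ursubmx (Q (i_ a)).
have QE a : Q (i_ a) = block_mx 0 (E a) (- E a) 0.
  have h0 : Q ord0 *m Q (i_ a) + Q (i_ a) *m Q ord0 = 0.
    by rewrite Q_cliff /= mulr0 raddf0.
  have h1 : Q (lift ord0 ord0) *m Q (i_ a) + Q (i_ a) *m Q (lift ord0 ord0) = 0.
    by rewrite Q_cliff /= mulr0 raddf0.
  move: h0 h1; rewrite Q0 Q1 -[Q (i_ a)]submxK -/(E a) !mulmx_block.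
  rewrite !(mul1mx, mulmx1, mul0mx, mulmx0, add0r, addr0, mulNmx, mulmxN).
  rewrite !add_block_mx -block_mx0.
  move=> /eq_block_mx[ul0 _ _ dr0] /eq_block_mx[e _ _ _].
  have {}dr0 : drsubmx (Q (i_ a)) = 0.
    by apply: mx_double_eq0; apply/eqP; rewrite -oppr_eq0 opprD; apply/eqP.
  congr block_mx => //; first exact: mx_double_eq0.
  by move/eqP: e; rewrite addr_eq0 => /eqP.
have E_skew a : (E a)^T = - E a.
  by have := Q_sym (i_ a); rewrite QE tr_block_mx => /eq_block_mx[].
have E_cliff a b : E a *m E b + E b *m E a = (- (2 * (a == b)%:R))%:M.
  have := Q_cliff (i_ a) (i_ b); rewrite !QE !mulmx_block.
  rewrite !(mul0mx, mulmx0, add0r, addr0, mulNmx, mulmxN) add_block_mx.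
  rewrite (inj_eq lift_inj) (inj_eq lift_inj) scalar_mx_block => /eq_block_mx[+ _ _ _].
  by rewrite -opprD => /eqP; rewrite eqr_oppLR => /eqP ->; rewrite raddfN.
exists A, E; split=> //; split=> //; split=> // a.
apply/eqP; rewrite E_skew mulNmx -subr_eq0 -oppr_eq0 opprB opprK addrC; apply/eqP.
have := E_cliff a a; rewrite eqxx mulr1 raddfN /= => e; apply: mx_double_eq0.
by rewrite addrACA e -raddfD /= -[1 + 1]/(2%:R) addNr.
Qed.

End NormalForm.

(** * Words in Clifford operators *)

Section Words.
Variables (R : realType) (W : lmodType R) (q : nat) (T : nat -> W -> W).
Hypothesis T_lin : forall a, linear (T a).
Hypothesis T_sqr : forall a x, T a (T a x) = - x.
Hypothesis T_anti : forall a b x, (a < q)%N -> (b < q)%N -> a != b ->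
  T a (T b x) = - T b (T a x).
Implicit Types (s t : seq nat) (x w : W).

(** The space W stays abstract because the same sign rules are applied on R^l, on F and on their
    product. *)
Definition word s x : W := foldr T x s.

Definition letters s : bool := all (gtn q) s.

Lemma word_cat s t x : word (s ++ t) x = word s (word t x).
Proof. exact: foldr_cat. Qed.

Lemma word_linear s : linear (word s).
Proof. by elim: s => [|a s IHs] c x y //=; rewrite IHs T_lin. Qed.

Lemma wordZ s c x : word s (c *: x) = c *: word s x.
Proof. exact: linZ (word_linear s) c x. Qed.

Lemma word_comm1 a s x : (a < q)%N -> letters s ->
  T a (word s x) = (-1) ^+ count (predC1 a) s *: word s (T a x).
Proof.
move=> a_q; elim: s => [|b s IHs] /=; first by rewrite expr0 scale1r.
case/andP=> b_q /IHs {}IHs; rewrite exprD -scalerA -(linZ (T_lin b)) -IHs eq_sym.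
have [<-|ab] := eqVneq a b; first by rewrite expr0 scale1r.
by rewrite T_anti // expr1 scaleN1r.
Qed.

Lemma word_comm s t x : letters s -> letters t ->
  word s (word t x) =
  (-1) ^+ sumn [seq count (predC1 a) t | a <- s] *: word t (word s x).
Proof.
move=> + t_q; elim: s => [|a s IHs] /=; first by rewrite expr0 scale1r.
case/andP=> a_q /IHs ->; rewrite (linZ (T_lin a)) word_comm1 //.
by rewrite scalerA -exprD addnC.
Qed.

(** Bringing the two copies of the first letter together crosses the rest of the word, and the
    square of that letter adds one more sign. *)
Fixpoint sqr_sign s : nat :=
  if s is a :: s' then (count (predC1 a) s' + sqr_sign s').+1 else 0%N.


Lemma word_sqr s x : letters s -> word s (word s x) = (-1) ^+ sqr_sign s *: x.
Proof.
elim: s => [|a s IHs] /=; first by rewrite expr0 scale1r.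
case/andP=> a_q s_q; have e := word_comm1 (word s x) a_q s_q.
have -> : word s (T a (word s x)) = (-1) ^+ count (predC1 a) s *: T a (word s (word s x)).
  by rewrite e scalerA -exprD addnn -mul2n exprM sqrrN expr1n expr1n scale1r.
rewrite (linZ (T_lin a)) T_sqr IHs // exprS mulN1r exprD scaleNr scalerN scalerA.
by [].
Qed.

Lemma word_front a t : letters t -> a \in t ->
  exists e : bool, forall x, word t x = (-1) ^+ e *: word (a :: rem a t) x.
Proof.
elim: t => [|b t IHt] //= /andP[b_q t_q]; rewrite inE.
have [<-|ab] := eqVneq a b => /= [_|a_t].
  by exists false => x; rewrite expr0 scale1r.
have [e et] := IHt t_q a_t; exists (~~ e) => x.
rewrite et (linZ (T_lin b)) /= T_anti //; last by rewrite eq_sym.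
  by rewrite scalerN -scaleNr; case: (e); rewrite ?opprK.
by move/allP: t_q => /(_ a a_t).
Qed.

Lemma word_perm s t : letters s -> perm_eq s t ->
  exists e : bool, forall x, word s x = (-1) ^+ e *: word t x.
Proof.
elim: s t => [|a s IHs] t.
  by move=> _; rewrite perm_sym => /perm_nilP ->; exists false => x; rewrite scale1r.
move=> st_q st; have t_q : letters t by rewrite /letters -(perm_all _ st).
have a_t : a \in t by rewrite -(perm_mem st) mem_head.
have [e1 te] := word_front t_q a_t.
have [||e2 se] := IHs (rem a t); first by case/andP: st_q.
  by rewrite -(perm_cons a); apply: perm_trans st _; exact: perm_to_rem.
exists (e1 (+) e2) => x; rewrite te /= se (linZ (T_lin a)) scalerA signr_addb.
by rewrite mulrAC -expr2 sqrr_sign mul1r.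
Qed.

(** The sign is left unspecified: it will only matter that it is the same for v and for the unit of
    F. *)
Definition stable s w : Prop := exists e : bool, word s w = (-1) ^+ e *: w.

Lemma stable_perm s t w : letters s -> perm_eq s t -> stable s w -> stable t w.
Proof.
move=> s_q /(word_perm s_q)[e st] [e' sw]; exists (e (+) e').
rewrite signr_addb -scalerA -sw st scalerA -expr2 sqrr_sign scale1r //.
Qed.

Lemma stable_cat s t w : stable s w -> stable t w -> stable (s ++ t) w.
Proof.
move=> [e sw] [e' tw]; exists (e' (+) e).
by rewrite word_cat tw wordZ sw scalerA signr_addb.
Qed.

Definition doubles s : seq nat := flatten [seq [:: a; a] | a <- s].

Lemma stable_doubles s t w : stable (doubles s ++ t) w -> stable t w.
Proof.
elim: s => [|a s IHs] //= [e sw]; apply: IHs; exists (~~ e).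
by move: sw; rewrite /= T_sqr => /eqP; rewrite eqr_oppLR => /eqP ->;
  rewrite -scaleNr; case: (e); rewrite ?opprK.
Qed.

(** Letters anticommute and have square -1, so up to sign a word depends only on the parity of each
    letter; d lists the pairs that cancel. *)
Lemma stable_reduce s d t w : letters s -> perm_eq s (doubles d ++ t) ->
  stable s w -> stable t w.
Proof. by move=> s_q st sw; apply: (@stable_doubles d); exact: stable_perm sw. Qed.

Lemma stable_mul c a b w : stable [:: c; a; b] w ->
  exists e : bool, T a (T b w) = (-1) ^+ e *: T c w.
Proof.
move=> [e /= /(congr1 (T c))]; rewrite T_sqr (linZ (T_lin c)) => /eqP.
rewrite eqr_oppLR => /eqP ->; exists (~~ e).
by rewrite -scaleNr; case: (e); rewrite ?opprK.
Qed.

(** The last condition, decided by computation, says that any two letters lie on a line, as in the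
    Fano plane; the third point c of the line through a and b expresses T_a T_b w. *)
Lemma stable_lines (lines : seq (seq nat)) w :
  all letters lines -> (forall s, s \in lines -> stable s w) ->
  all (fun a => all (fun b => (a == b) || has (fun c =>
    has (fun s => perm_eq s [:: c; a; b]) lines) (iota 0 q)) (iota 0 q)) (iota 0 q) ->
  forall a b, (a < q)%N -> (b < q)%N -> a != b ->
  exists c (e : bool), (c < q)%N /\ T a (T b w) = (-1) ^+ e *: T c w.
Proof.
move=> /allP lines_q lines_w check a b a_q b_q ab.
move: check => /allP/(_ a); rewrite mem_iota a_q => /(_ isT)/allP/(_ b).
rewrite mem_iota b_q (negbTE ab) => /(_ isT)/hasP[c].
rewrite mem_iota => /andP[_ c_q] /hasP[s s_in sP].
have [e we] := stable_mul (stable_perm (lines_q s s_in) sP (lines_w s s_in)).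
by exists c, e.
Qed.

End Words.

(** * Eigenvectors of involutions on a subspace *)

Section Selection.
Variables (R : realType) (V : lmodType R) (K : V -> Prop) (A : V -> V).
Hypothesis A_lin : linear A.
Hypothesis A_sqr : forall x, A (A x) = x.
Hypothesis K_lin : forall (c : R) x y, K x -> K y -> K (c *: x + y).
Hypothesis K_A : forall x, K x -> K (A x).

(** e A x + x is an eigenvector for e, unless it vanishes, in which case x is one for - e. *)
Lemma eigenvector_or (e : R) x : e * e = 1 -> K x -> x != 0 ->
  A x = - (e *: x) \/ exists y, [/\ K y, y != 0 & A y = e *: y].
Proof.
move=> ee Kx x0; have [/eqP|y0] := eqVneq (e *: A x + x) 0.
  rewrite addr_eq0 => /eqP eAx; left.
  by rewrite -[A x]scale1r -ee -scalerA eAx scalerN.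
right; exists (e *: A x + x); split=> //; first by apply: K_lin => //; exact: K_A.
by rewrite A_lin A_sqr scalerDr scalerA ee scale1r addrC.
Qed.

(** F anticommutes with A, so it exchanges the two eigenspaces; it is injective because its square
    is -1. *)
Lemma eigenvector_flip (F : V -> V) (e : R) x : linear F ->
  (forall y, K y -> K (F y)) -> (forall y, F (F y) = - y) ->
  (forall y, A (F y) = - F (A y)) ->
  e * e = 1 -> K x -> x != 0 -> exists y, [/\ K y, y != 0 & A y = e *: y].
Proof.
move=> F_lin K_F F_sqr AF ee Kx x0.
have [Ax|//] := eigenvector_or ee Kx x0; exists (F x); split; first exact: K_F.
  by apply/eqP => Fx; case/eqP: x0; rewrite -[x]opprK -(F_sqr x) Fx (lin0 F_lin) oppr0.
by rewrite AF Ax (linN F_lin) (linZ F_lin) opprK.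
Qed.

End Selection.

(** * Identification of R^l with F^k *)

Section UnitMultiplication.
Variables (R : realType) (q : nat).
Variable mul : 'rV[R]_q.+1 -> 'rV[R]_q.+1 -> 'rV[R]_q.+1.
Hypothesis mulP : composition_algebra mul.
Implicit Types (a b : 'I_q) (x y : 'rV[R]_q.+1).

Lemma dot_unit a b : dot (funit R a) (funit R b) = (a == b)%:R.
Proof. by rewrite dot_delta !mxE eqxx (inj_eq lift_inj) eq_sym. Qed.

Lemma unit_mulK a y : mul (funit R a) (mul (funit R a) y) = - y.
Proof.
have := conj_mulK mulP (funit R a) y.
rewrite fconj_unit (fmulNl mulP) dot_unit eqxx scale1r => /eqP.
by rewrite eqr_oppLR => /eqP.
Qed.

(** The identity conj(x) (x y) = |x|^2 y is polarized at x = e_a + e_b. *)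
Lemma unit_mul_anti a b y : a != b ->
  mul (funit R a) (mul (funit R b) y) = - mul (funit R b) (mul (funit R a) y).
Proof.
move=> /negbTE ab; have := conj_mulK mulP (funit R a + funit R b) y.
rewrite (linD (@fconj_linear R q)) !fconj_unit -opprD (fmulNl mulP).
rewrite !(fmulDl mulP) !(fmulDr mulP) !unit_mulK dot_sqrD !dot_unit ab !eqxx.
move: (mul _ (mul (funit R b) y)) (mul _ (mul (funit R a) y)) => u v e.
by apply/rowP => j; have := congr1 (fun w : 'rV[R]_q.+1 => w 0 j) e; rewrite !mxE /=; lra.
Qed.

(** Left multiplication by e_a; the transpose lets it act on columns, as E_a does. *)
Definition unit_mx a : 'M[R]_q.+1 := (lin1_mx (mul (funit R a)))^T.

Lemma unit_mxE a y : unit_mx a *m y^T = (mul (funit R a) y)^T.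
Proof.
have [g gE] := linear_packed (mul_linr mulP (funit R a)).
by rewrite /unit_mx gE -trmx_mul mul_rV_lin1.
Qed.

Lemma unit_mx_skew a : (unit_mx a)^T = - unit_mx a.
Proof.
apply/matrixP => i j; rewrite [RHS]mxE [LHS]mxE.
have cE (A : 'M[R]_q.+1) i' j' :
    A i' j' = dot (A *m (delta_mx 0 j')^T) (delta_mx 0 i' : 'rV_q.+1)^T.
  by rewrite trmx_delta trmx_delta -colE dot_delta mxE.
rewrite !cE !unit_mxE.
have dotT x y : dot x^T y^T = dot x y.
  by rewrite !dotE trmxK -mxtrace_tr trmx_mul trmxK mxtrace_mulC.
by rewrite !dotT (dot_mull mulP) fconj_unit (fmulNl mulP) dotNr dotC.
Qed.

End UnitMultiplication.

Section Blocks.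
Variables (R : realType) (q l : nat).
Variable mul : 'rV[R]_q.+1 -> 'rV[R]_q.+1 -> 'rV[R]_q.+1.
Hypothesis mulP : composition_algebra mul.
Variable E : 'I_q -> 'M[R]_l.
Hypothesis E_cliff : skew_clifford E.
Implicit Types (a b : 'I_q) (x y : 'rV[R]_q.+1) (v : 'cV[R]_l).

Let E_skew a : (E a)^T = - E a. Proof. by case: E_cliff. Qed.

Lemma skew_sqr a : E a *m E a = - 1%:M.
Proof.
by case: E_cliff => _ /(_ a); rewrite E_skew mulNmx => <-; rewrite opprK.
Qed.

Lemma skew_anti a b : a != b -> E a *m E b = - (E b *m E a).
Proof.
move=> /negbTE ab; case: E_cliff => _ _ /(_ a b).
by rewrite ab mulr0 oppr0 raddf0 => /eqP; rewrite addr_eq0 => /eqP.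
Qed.

Definition intertwining_block (b : 'M[R]_(q.+1, l)) (e : R) : Prop :=
  e * e = 1 /\ forall a, b *m E a = e *: (unit_mx mul a *m b).

Lemma intertwining_comm (b : 'M[R]_(q.+1, l)) (e : R) a : intertwining_block b e ->
  b^T *m b *m E a = E a *m (b^T *m b).
Proof.
move=> [_ bE]; rewrite -mulmxA bE mulmxA -[E a in RHS]opprK -E_skew !mulNmx.
rewrite -trmx_mul bE -scalemxAr linearZ /= trmx_mul (unit_mx_skew mulP).
by rewrite mulmxN scalerN mulNmx opprK -scalemxAl mulmxA.
Qed.

(* The vector v plays the part of 1, the frame (v, e E_1 v, ..., e E_q v)
   that of the basis (1, e_1, ..., e_q) of F. *)
Definition frame v (e : R) : 'M[R]_(q.+1, l) :=
  \matrix_i (if unlift ord0 i is Some a then (e *: (E a *m v))^T else v^T).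

(** On v the operators e E_a must follow the multiplication table of the units e_a, with the same
    third index and the same sign. *)
Definition adapted v (e : R) : Prop :=
  e * e = 1 /\ forall a b, a != b -> exists c (s : bool),
    (e *: E a) *m ((e *: E b) *m v) = (-1) ^+ s *: ((e *: E c) *m v) /\
    mul (funit R a) (funit R b) = (-1) ^+ s *: funit R c.

Lemma trmx_frame_one v e : (frame v e)^T *m fone^T = v.
Proof. by rewrite -trmx_mul -rowE rowK unlift_none trmxK. Qed.

Lemma trmx_frame_unit v e a : (frame v e)^T *m (funit R a)^T = e *: (E a *m v).
Proof. by rewrite -trmx_mul -rowE rowK liftK trmxK. Qed.

Lemma frame_intertwining v e : adapted v e -> intertwining_block (frame v e) e.
Proof.
move=> [ee ad]; split=> // a.
have on_basis i : (frame v e)^T *m (unit_mx mul a *m (delta_mx 0 i : 'rV_q.+1)^T) =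
    e *: E a *m ((frame v e)^T *m (delta_mx 0 i : 'rV_q.+1)^T).
  rewrite (unit_mxE mulP); case: (unliftP ord0 i) => [b|] ->; last first.
    by rewrite (mul_1r mulP) trmx_frame_one trmx_frame_unit scalemxAl.
  rewrite -/(funit R b) trmx_frame_unit; have [->|ab] := eqVneq a b.
    have := unit_mulK mulP b fone; rewrite (mul_1r mulP) => ->.
    rewrite linearN mulmxN /= trmx_frame_one -scalemxAr -scalemxAl scalerA ee.
    by rewrite scale1r mulmxA skew_sqr mulNmx mul1mx.
  have [c [s [Es ->]]] := ad a b ab.
  rewrite linearZ /= -scalemxAr trmx_frame_unit.
  by rewrite [e *: (E c *m v)]scalemxAl [e *: (E b *m v)]scalemxAl Es.
have e1 : (frame v e)^T *m unit_mx mul a = e *: E a *m (frame v e)^T.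
  apply/matrixP => i j; have := congr1 (fun M : 'cV[R]_l => M i 0) (on_basis j).
  by rewrite !mulmxA !trmx_delta -!colE [LHS]mxE [RHS]mxE.
(* Transposition gives the claim; the signs from the two skew matrices cancel. *)
have := congr1 trmx e1; rewrite !trmx_mul (unit_mx_skew mulP) trmxK linearZ /= E_skew.
rewrite mulNmx -scalemxAr mulmxN scalerN => /oppr_inj ->.
by rewrite scalerA ee scale1r.
Qed.

Lemma skew_form v a : v^T *m (E a *m v) = 0.
Proof.
apply: mx_double_eq0; apply/eqP; rewrite addr_eq0; apply/eqP.
have tr1 (M : 'M[R]_1) : M^T = M by apply/matrixP => i j; rewrite !ord1 mxE.
by rewrite -{1}[LHS]tr1 !trmx_mul trmxK E_skew mulmxN mulNmx mulmxA.
Qed.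

(* The Gram matrix of the frame commutes with the multiplications by the e_a
   and fixes 1, hence fixes every e_a. *)
Lemma frame_orthonormal v e : adapted v e -> v^T *m v = 1%:M ->
  frame v e *m (frame v e)^T = 1%:M.
Proof.
move=> ad v1; have [ee bE] := frame_intertwining ad; set b := frame v e in bE *.
have bEt a : E a *m b^T = e *: (b^T *m unit_mx mul a).
  apply: oppr_inj; rewrite -mulNmx -E_skew -trmx_mul bE linearZ /= trmx_mul.
  by rewrite (unit_mx_skew mulP) mulmxN scalerN.
have comm a : b *m b^T *m unit_mx mul a = unit_mx mul a *m (b *m b^T).
  have -> : unit_mx mul a *m (b *m b^T) = e *: (b *m E a *m b^T).
    by rewrite bE -scalemxAl scalerA ee scale1r mulmxA.
  by rewrite -[in RHS]mulmxA bEt -scalemxAr scalerA ee scale1r mulmxA.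
have fix1 : b *m b^T *m fone^T = fone^T.
  rewrite -mulmxA trmx_frame_one; apply/row_matrixP => i; rewrite row_mul rowK.
  apply/matrixP => x y; rewrite !ord1 [RHS]mxE [RHS]mxE.
  case: (unliftP ord0 i) => [a|] ->; last by rewrite v1 !mxE.
  rewrite linearZ /= -scalemxAl trmx_mul E_skew mulmxN mulNmx -mulmxA skew_form.
  by rewrite oppr0 scaler0 !mxE.
have fix_unit a : b *m b^T *m (funit R a)^T = (funit R a)^T.
  rewrite -[funit R a](mul_1r mulP) -(unit_mxE mulP) mulmxA comm -mulmxA fix1.
  by [].
apply/matrixP => i j.
have cE (M : 'M[R]_q.+1) : M i j = (M *m (delta_mx 0 j : 'rV_q.+1)^T) i 0.
  by rewrite trmx_delta -colE mxE.
rewrite cE [RHS]cE mul1mx.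
by case: (unliftP ord0 j) => [a|] ->; rewrite ?fix1 ?fix_unit.
Qed.

End Blocks.

(** * Adapted vectors as common eigenvectors of words *)

Section AdaptedVectors.
Variables (R : realType) (q l : nat).
Variable mul : 'rV[R]_q.+2 -> 'rV[R]_q.+2 -> 'rV[R]_q.+2.
Hypothesis mulP : composition_algebra mul.
Variable E : 'I_q.+1 -> 'M[R]_l.
Hypothesis E_cliff : skew_clifford E.
Variable M : 'M[R]_l.
Hypothesis M_idem : M *m M = M.
Hypothesis M_comm : forall a, M *m E a = E a *m M.

Definition clifford_op (e : R) (a : nat) (x : 'cV[R]_l) : 'cV[R]_l :=
  (e *: E (inord a)) *m x.

Definition unit_op (a : nat) (y : 'rV[R]_q.+2) : 'rV[R]_q.+2 :=
  mul (funit R (inord a : 'I_q.+1)) y.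

Lemma clifford_op_linear e a : linear (clifford_op e a).
Proof. by move=> c x y; rewrite /clifford_op mulmxDr -scalemxAr. Qed.

Lemma clifford_op_sqr e a x : e * e = 1 -> clifford_op e a (clifford_op e a x) = - x.
Proof.
move=> ee; rewrite /clifford_op mulmxA -scalemxAl -scalemxAr scalerA ee scale1r.
by rewrite (skew_sqr E_cliff) mulNmx mul1mx.
Qed.

Lemma inord_neq a b : (a < q.+1)%N -> (b < q.+1)%N -> a != b ->
  (inord a : 'I_q.+1) != inord b.
Proof. by move=> aq bq; rewrite -val_eqE /= !inordK. Qed.

Lemma clifford_op_anti e a b x : (a < q.+1)%N -> (b < q.+1)%N -> a != b ->
  clifford_op e a (clifford_op e b x) = - clifford_op e b (clifford_op e a x).
Proof.
move=> aq bq ab; rewrite /clifford_op !mulmxA -!scalemxAl -!scalemxAr.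
by rewrite (skew_anti E_cliff (inord_neq aq bq ab)) !(mulNmx, scalerN).
Qed.

Lemma unit_op_linear a : linear (unit_op a).
Proof. exact: mul_linr mulP _. Qed.

Lemma unit_op_sqr a x : unit_op a (unit_op a x) = - x.
Proof. exact: unit_mulK mulP _ _. Qed.

Lemma unit_op_anti a b x : (a < q.+1)%N -> (b < q.+1)%N -> a != b ->
  unit_op a (unit_op b x) = - unit_op b (unit_op a x).
Proof. by move=> aq bq /(inord_neq aq bq) /(unit_mul_anti mulP); apply. Qed.

Definition fixes e (ss : seq (seq nat)) (x : 'cV[R]_l) : Prop :=
  M *m x = x /\ forall s, s \in ss -> word (clifford_op e) s x = - x.

Lemma clifford_op_M e a x : M *m clifford_op e a x = clifford_op e a (M *m x).
Proof. by rewrite /clifford_op !mulmxA -scalemxAr -scalemxAl M_comm. Qed.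

Lemma word_M e s x :
  M *m word (clifford_op e) s x = word (clifford_op e) s (M *m x).
Proof. by elim: s => [|a s IHs] //=; rewrite clifford_op_M IHs. Qed.

Lemma fixes_linear e ss c x y :
  fixes e ss x -> fixes e ss y -> fixes e ss (c *: x + y).
Proof.
move=> [Mx sx] [My sy]; split=> [|s s_ss]; first by rewrite mulmxDr -scalemxAr Mx My.
rewrite (word_linear (clifford_op_linear e)) sx // sy //.
by rewrite scalerN opprD.
Qed.

Lemma signr_even_eq1 n : ~~ odd n -> (-1) ^+ n = 1 :> R.
Proof. by move=> /negbTE nE; rewrite -signr_odd nE. Qed.

Lemma signr_odd_eqN1 n : odd n -> (-1) ^+ n = -1 :> R.
Proof. by move=> nO; rewrite -signr_odd nO. Qed.

Lemma fixes_word e ss t x : e * e = 1 -> all (letters q.+1) ss -> letters q.+1 t ->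
  all (fun s => ~~ odd (sumn [seq count (predC1 a) t | a <- s])) ss ->
  fixes e ss x -> fixes e ss (word (clifford_op e) t x).
Proof.
move=> ee /allP ss_q t_q /allP comm [Mx sx]; split; first by rewrite word_M Mx.
move=> s s_ss; rewrite (word_comm (clifford_op_linear e) _ _ (ss_q s s_ss) t_q).
  rewrite signr_even_eq1 ?comm // scale1r sx // (linN (word_linear _ _)) //.
  exact: clifford_op_linear.
exact: clifford_op_anti.
Qed.

(** The parity conditions say that the word t is an involution commuting with the words of ss, and
    that the operator a commutes with the latter but anticommutes with t. It thus exchanges the
    eigenspaces of t, and the eigenvalue -1 can be reached. *)
Lemma flip_step e ss t a : e * e = 1 -> (a < q.+1)%N ->
  all (letters q.+1) (t :: ss) -> ~~ odd (sqr_sign t) ->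
  all (fun s => ~~ odd (sumn [seq count (predC1 a) t | a <- s])) ss ->
  all (fun s => ~~ odd (count (predC1 a) s)) ss -> odd (count (predC1 a) t) ->
  (exists x, fixes e ss x /\ x != 0) ->
  exists x, fixes e (t :: ss) x /\ x != 0.
Proof.
move=> ee aq /andP[t_q ss_q] t_sqr t_comm a_comm a_anti [x [Kx x0]].
have T_lin := clifford_op_linear e.
have T_sqr b y := @clifford_op_sqr e b y ee.
have T_anti := @clifford_op_anti e.
have NN : (-1 : R) * -1 = 1 by rewrite mulrNN mulr1.
have [||||||||y [Ky y0 ty]] := @eigenvector_flip R 'cV[R]_l (fixes e ss)
    (word (clifford_op e) t) _ _ _ _ (clifford_op e a) (-1) x _ _ _ _ NN Kx x0.
- exact: word_linear.
- by move=> y; rewrite (word_sqr T_lin T_sqr T_anti) // signr_even_eq1 // scale1r.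
- exact: fixes_linear.
- by move=> y; exact: fixes_word.
- exact: T_lin.
- move=> y [My sy]; split; first by rewrite clifford_op_M My.
  move=> s s_ss; have s_q := allP ss_q s s_ss.
  have := word_comm1 T_lin T_anti y aq s_q.
  by rewrite sy // signr_even_eq1 ?(allP a_comm) // scale1r (linN (T_lin a)) => <-.
- exact: T_sqr.
- move=> y; have := word_comm1 T_lin T_anti y aq t_q.
  by rewrite signr_odd_eqN1 // scaleN1r => ->; rewrite opprK.
exists y; split=> //; case: Ky => My sy; split=> // s.
by rewrite inE => /predU1P[->|/sy //]; rewrite ty scaleN1r.
Qed.

Lemma word_sign s x :
  word (clifford_op (-1)) s x = (-1) ^+ size s *: word (clifford_op 1) s x.
Proof.
elim: s => [|a s IHs] /=; first by rewrite scale1r.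
rewrite IHs (linZ (clifford_op_linear _ _)) /clifford_op scaleN1r scale1r mulNmx.
by rewrite exprS mulN1r scaleNr scalerN.
Qed.

(** Applied to the word of all letters, which is central for an odd number of them, so that no
    operator flips its sign. The sign e does: replacing e by - e negates a word of odd length. *)
Lemma volume_step s : letters q.+1 s -> ~~ odd (sqr_sign s) -> odd (size s) ->
  M != 0 -> exists e, e * e = 1 /\ exists x, fixes e [:: s] x /\ x != 0.
Proof.
move=> s_q s_sqr s_odd M0.
have [x [Mx x0]] : exists x : 'cV[R]_l, M *m x = x /\ x != 0.
  have [/forallP all0|] := boolP [forall i, col i M == 0].
    case/eqP: M0; apply/matrixP => i j; have /eqP := all0 j.
    by move=> /(congr1 (fun w : 'cV[R]_l => w i 0)); rewrite !mxE.
  rewrite negb_forall => /existsP[i Mi]; exists (col i M); split=> //.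
  by rewrite !colE mulmxA M_idem.
have T_lin := clifford_op_linear 1.
have T_sqr b y := @clifford_op_sqr 1 b y (mul1r 1).
have T_anti := @clifford_op_anti 1.
have NN : (-1 : R) * -1 = 1 by rewrite mulrNN mulr1.
have [||||sx|[y [Ky y0 sy]]] := @eigenvector_or R 'cV[R]_l (fun y => M *m y = y)
    (word (clifford_op 1) s) _ _ _ _ (-1) x NN Mx x0.
- exact: word_linear.
- by move=> y; rewrite (word_sqr T_lin T_sqr T_anti) // signr_even_eq1 // scale1r.
- by move=> c y z My Mz; rewrite mulmxDr -scalemxAr My Mz.
- by move=> y My; rewrite word_M My.
- exists (-1); split=> //; exists x; split=> //; split=> // t; rewrite inE => /eqP ->.
  by rewrite word_sign signr_odd_eqN1 // sx !scaleN1r opprK.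
- exists 1; rewrite mulr1; split=> //; exists y; split=> //; split=> // t.
  by rewrite inE => /eqP ->; rewrite sy scaleN1r.
Qed.

(* Running the two Clifford actions in parallel gives the same signs for v and
   for the unit of F. *)
Lemma fixes_adapted e ss lines v : e * e = 1 -> fixes e ss v ->
  (forall s, s \in ss -> word unit_op s fone = - fone) ->
  (forall (W : lmodType R) (T : nat -> W -> W) (w : W),
     (forall a, linear (T a)) -> (forall a x, T a (T a x) = - x) ->
     (forall a b x, (a < q.+1)%N -> (b < q.+1)%N -> a != b ->
        T a (T b x) = - T b (T a x)) ->
     (forall s, s \in ss -> stable T s w) ->
     forall s, s \in lines -> stable T s w) ->
  all (letters q.+1) lines ->
  all (fun a => all (fun b => (a == b) || has (fun c =>
    has (fun s => perm_eq s [:: c; a; b]) lines) (iota 0 q.+1)) (iota 0 q.+1))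
    (iota 0 q.+1) ->
  adapted mul E v e.
Proof.
move=> ee [_ sv] s1 derive lines_q check; split=> // a b ab.
pose T n (u : 'cV[R]_l * 'rV[R]_q.+2) := (clifford_op e n u.1, unit_op n u.2).
have wordT s u : word T s u = (word (clifford_op e) s u.1, word unit_op s u.2).
  by elim: s => [|n s IHs] /=; [case: u | rewrite IHs].
have T_lin n : linear (T n).
  by move=> c u w; rewrite /T /= clifford_op_linear unit_op_linear.
have T_sqr n u : T n (T n u) = - u.
  by rewrite /T /= (clifford_op_sqr _ _ ee) unit_op_sqr; case: u.
have T_anti m n u : (m < q.+1)%N -> (n < q.+1)%N -> m != n ->
    T m (T n u) = - T n (T m u).
  by move=> mq nq mn; rewrite /T /= clifford_op_anti // unit_op_anti.
have lines_w : forall s, s \in lines -> stable T s (v, fone).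
  apply: derive => // s s_ss; exists true; rewrite wordT /= sv // s1 //.
  by rewrite expr1 scaleN1r.
have [c [s [_ Ts]]] := stable_lines T_lin T_sqr T_anti lines_q lines_w check
  (ltn_ord a) (ltn_ord b) ab.
exists (inord c), s; case: Ts; rewrite /clifford_op /unit_op !inord_val => -> .
by rewrite !(mul_1r mulP) => ->.
Qed.

End AdaptedVectors.

(** All that the block decomposition needs to know about the particular algebra; M will be the
    projection onto the part not yet decomposed. *)
Definition has_adapted_vectors (R : realType) (q : nat)
    (mul : 'rV[R]_q.+1 -> 'rV[R]_q.+1 -> 'rV[R]_q.+1) : Prop :=
  forall l (E : 'I_q -> 'M[R]_l), skew_clifford E ->
  forall M : 'M[R]_l, M *m M = M -> (forall a, M *m E a = E a *m M) -> M != 0 ->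
  exists v e, [/\ M *m v = v, v != 0 & adapted mul E v e].

Lemma crd_unit (R : realType) (q a n : nat) : (a < q.+1)%N -> (n < q.+2)%N ->
  crd (funit R (inord a : 'I_q.+1)) n = (n == a.+1)%:R.
Proof.
by move=> aq nq; rewrite /crd mxE eqxx -val_eqE /= !inordK.
Qed.

Section QuaternionVectors.
Variable R : realType.

Lemma quaternion_word : word (unit_op (@qmul R)) [:: 0; 1; 2]%N fone = - fone.
Proof.
rewrite /= /unit_op (mul_1r (@qmul_composition R)).
by apply: crd4P; rewrite !crd4E !crd_unit //=; ring.
Qed.

Lemma quaternion_adapted_vectors : has_adapted_vectors (@qmul R).
Proof.
move=> l E E_cliff M M_idem M_comm M0.
have [//|//|//|e [ee [v [fv v0]]]] :=
  @volume_step R 2 l E E_cliff M M_idem M_comm [:: 0; 1; 2]%N _ _ _ M0.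
exists v, e; split=> //; first by case: fv.
apply: (@fixes_adapted R 2 l _ (@qmul_composition R) E E_cliff M e _
  [:: [:: 0; 1; 2]%N] v ee fv) => // s.
by rewrite inE => /eqP ->; exact: quaternion_word.
Qed.

End QuaternionVectors.

Section OctonionVectors.
Variable R : realType.

Local Notation oct := (unit_op (@omul R)).
Local Notation fu n := (funit R (inord n%N : 'I_7)).
Local Ltac crd8_unit :=
  by rewrite /unit_op; apply: crd8P; rewrite !crd8E !crd_unit //=; ring.

(** These five products are the ones met when the words of [octonion_words] are evaluated at 1 from
    the right. *)
Lemma ounit_12 : oct 1 (fu 2) = fu 0.
Proof. crd8_unit. Qed.

Lemma ounit_34 : oct 3 (fu 4) = fu 0.
Proof. crd8_unit. Qed.

Lemma ounit_35 : oct 3 (fu 5) = fu 1.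
Proof. crd8_unit. Qed.

Lemma ounit_40 : oct 4 (fu 0) = fu 3.
Proof. crd8_unit. Qed.

Lemma ounit_56 : oct 5 (fu 6) = - fu 0.
Proof. crd8_unit. Qed.

Let oct_square n : oct n (fu n) = - fone.
Proof.
by have := unit_op_sqr (@omul_composition R) n fone;
  rewrite {2}/unit_op (mul_1r (@omul_composition R)).
Qed.

Let oct_one n : oct n fone = fu n.
Proof. exact: mul_1r (@omul_composition R) _. Qed.

Let octN n x : oct n (- x) = - oct n x.
Proof. exact: linN (unit_op_linear (@omul_composition R) n) x. Qed.

Let oct_simpl := (ounit_12, ounit_34, ounit_35, ounit_40, ounit_56, octN, oct_one, oct_square).

(** Three lines and the volume word, listed in reverse order of treatment so that each stage is a
    [drop] of the list. *)
Definition octonion_words : seq (seq nat) :=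
  [:: [:: 1; 3; 5]; [:: 0; 3; 4]; [:: 0; 1; 2]; [:: 0; 1; 2; 3; 4; 5; 6]]%N.

(** The seven lines of the Fano plane, letter a standing for e_(a+1). *)
Definition octonion_lines : seq (seq nat) :=
  [:: [:: 0; 1; 2]; [:: 0; 3; 4]; [:: 0; 5; 6]; [:: 1; 3; 5]; [:: 1; 4; 6];
      [:: 2; 3; 6]; [:: 2; 4; 5]]%N.

Lemma octonion_word s : s \in octonion_words -> word oct s fone = - fone.
Proof.
by rewrite !inE => /or4P[] /eqP ->; rewrite /= !oct_simpl ?opprK.
Qed.

(* The last four lines are products of the given words, up to sign. *)
Lemma octonion_lines_stable (W : lmodType R) (T : nat -> W -> W) (w : W) :
  (forall a, linear (T a)) -> (forall a x, T a (T a x) = - x) ->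
  (forall a b x, (a < 7)%N -> (b < 7)%N -> a != b ->
     T a (T b x) = - T b (T a x)) ->
  (forall s, s \in octonion_words -> stable T s w) ->
  forall s, s \in octonion_lines -> stable T s w.
Proof.
move=> T_lin T_sqr T_anti sw.
have s135 : stable T [:: 1; 3; 5]%N w by apply: sw; rewrite !inE eqxx.
have s034 : stable T [:: 0; 3; 4]%N w by apply: sw; rewrite !inE eqxx orbT.
have s012 : stable T [:: 0; 1; 2]%N w by apply: sw; rewrite !inE eqxx !orbT.
have vol : stable T [:: 0; 1; 2; 3; 4; 5; 6]%N w.
  by apply: sw; rewrite !inE eqxx !orbT.
have red := stable_reduce T_lin T_sqr T_anti.
have cat := stable_cat T_lin.
(* The list passed to [red] consists of the letters occurring twice in the concatenation: 0, 1, 3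
   cancel and 2, 4, 5 remain. The next three lines arise likewise. *)
have s245 : stable T [:: 2; 4; 5]%N w.
  by apply: (red _ [:: 0; 1; 3]%N _ _ _ _ (cat _ _ _ s012 (cat _ _ _ s034 s135))).
have s056 : stable T [:: 0; 5; 6]%N w.
  by apply: (red _ [:: 0; 1; 2; 3; 4]%N _ _ _ _ (cat _ _ _ vol (cat _ _ _ s012 s034))).
have s146 : stable T [:: 1; 4; 6]%N w.
  by apply: (red _ [:: 0; 1; 2; 3; 5]%N _ _ _ _ (cat _ _ _ vol (cat _ _ _ s012 s135))).
have s236 : stable T [:: 2; 3; 6]%N w.
  by apply: (red _ [:: 0; 1; 3; 4; 5]%N _ _ _ _ (cat _ _ _ vol (cat _ _ _ s034 s135))).
move=> s; rewrite !inE.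
by case/predU1P=> [->//|/or4P[/eqP->//|/eqP->//|/eqP->//|/or3P[]/eqP->//]].
Qed.

Lemma octonion_adapted_vectors : has_adapted_vectors (@omul R).
Proof.
move=> l E E_cliff M M_idem M_comm M0.
have [//|//|//|e [ee x0]] := @volume_step R 6 l E E_cliff M M_idem M_comm
  [:: 0; 1; 2; 3; 4; 5; 6]%N _ _ _ M0.
pose ss n := drop n octonion_words.
have flip := @flip_step R 6 l E E_cliff M M_comm e _ _ _ ee.
(* A letter commutes with a line exactly when it lies on it, and always with the volume word. The
   flipping letters 3, 1, 0 are therefore off the new line but on every line already treated. *)
have x1 := flip (ss 3%N) [:: 0; 1; 2]%N 3%N isT isT isT isT isT isT x0.
have x2 := flip (ss 2%N) [:: 0; 3; 4]%N 1%N isT isT isT isT isT isT x1.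
have [v [fv v0]] := flip (ss 1%N) [:: 1; 3; 5]%N 0%N isT isT isT isT isT isT x2.
exists v, e; split=> //; first by case: fv.
exact: (fixes_adapted (@omul_composition R) E_cliff ee fv octonion_word
  octonion_lines_stable).
Qed.

End OctonionVectors.

Lemma prod_mx_iota (R : realType) (m n : nat) (F : nat -> 'M[R]_n) :
  \prod_(i < m) F i = \prod_(i <- iota 0 m) F i.
Proof. by rewrite -(big_mkord xpredT F) /index_iota subn0. Qed.

Section Volume.
Variables (R : realType) (q : nat).
Variable mul : 'rV[R]_q.+2 -> 'rV[R]_q.+2 -> 'rV[R]_q.+2.
Hypothesis mulP : composition_algebra mul.
Hypothesis q_even : ~~ odd q.
Hypothesis volume_one : word (unit_op mul) (iota 0 q.+1) fone = - fone.

(* The number q + 1 of factors being odd, the volume element is central, so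
   that it acts on e_a = e_a 1 as it acts on 1. *)
Lemma volume_word y : word (unit_op mul) (iota 0 q.+1) y = - y.
Proof.
have T_lin := unit_op_linear mulP.
have T_anti := unit_op_anti mulP.
have vol_lin := word_linear T_lin (iota 0 q.+1).
rewrite {1}[y]row_sum_delta [in RHS](row_sum_delta y) (lin_sum vol_lin) -sumrN.
apply: eq_bigr => j _; rewrite (linZ vol_lin) -scalerN; congr (_ *: _).
case: (unliftP ord0 j) => [a|] -> //; rewrite -/(funit R a).
have aE : funit R a = unit_op mul a fone by rewrite /unit_op (mul_1r mulP) inord_val.
have iota_q : letters q.+1 (iota 0 q.+1).
  by apply/allP => i; rewrite mem_iota.
rewrite aE -(linN (T_lin a)) -volume_one (word_comm1 T_lin T_anti _ (ltn_ord a) iota_q).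
rewrite signr_even_eq1 ?scale1r //.
have := count_predC (pred1 (a : nat)) (iota 0 q.+1).
rewrite size_iota count_uniq_mem ?iota_uniq // mem_iota ltn_ord add1n => -[e].
by rewrite (_ : count _ _ = q).
Qed.

Lemma prod_unit_mx : \prod_(a < q.+1) unit_mx mul a = - 1%:M.
Proof.
have prodE s y : (\prod_(i <- s) unit_mx mul (inord i)) *m y^T =
    (word (unit_op mul) s y)^T.
  elim: s => [|i s IHs]; first by rewrite big_nil mul1mx.
  by rewrite big_cons -mulmxA IHs (unit_mxE mulP).
under eq_bigr => a _ do rewrite -{1}(inord_val a).
rewrite (prod_mx_iota _ (fun i => unit_mx mul (inord i))).
apply/matrixP => i j.
have cE (M : 'M[R]_q.+2) : M i j = (M *m (delta_mx 0 j : 'rV_q.+2)^T) i 0.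
  by rewrite trmx_delta -colE mxE.
by rewrite cE [RHS]cE prodE volume_word mulNmx mul1mx linearN.
Qed.

End Volume.

(** * Splitting R^l into copies of F, and the trace *)

Section BlockDecomposition.
Variables (R : realType) (q l : nat).
Variable mul : 'rV[R]_q.+1 -> 'rV[R]_q.+1 -> 'rV[R]_q.+1.
Hypothesis mulP : composition_algebra mul.
Variable E : 'I_q -> 'M[R]_l.
Hypothesis E_cliff : skew_clifford E.

Definition signb (c : bool) : R := if c then 1 else -1.

Definition block_decomposition (j : nat) (b : nat -> 'M[R]_(q.+1, l))
    (plus : nat -> bool) : Prop :=
  [/\ forall i, (i < j)%N -> intertwining_block mul E (b i) (signb (plus i)),
      forall i k, (i < j)%N -> (k < j)%N -> b i *m (b k)^T = (i == k)%:R%:M &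
      \sum_(i < j) (b i)^T *m b i = 1%:M].

Lemma block_decomposition_exists : has_adapted_vectors mul ->
  exists j b plus, (j * q.+1)%N = l /\ block_decomposition j b plus.
Proof.
move=> adv.
pose Q b := exists e, intertwining_block mul E b e.
have Q_comm b t : Q b -> b^T *m b *m E t = E t *m (b^T *m b).
  by move=> [e]; exact: intertwining_comm.
have Q_ext (M : 'M[R]_l) : M^T = M -> M *m M = M ->
    (forall t, M *m E t = E t *m M) -> M != 0 ->
    exists c, [/\ Q c, c *m c^T = 1%:M & c *m M = c].
  move=> M_sym M_idem M_comm M0.
  have [v [e [Mv v0 ad]]] := adv _ _ E_cliff M M_idem M_comm M0.
  have vT0 : v^T != 0 by rewrite -(inj_eq (can_inj (@trmxK _ _ _))) trmxK trmx0.
  have [c vc] := unit_row vT0.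
  have {}vc : (c *: v)^T *m (c *: v) = 1%:M.
    by move: vc; rewrite (_ : c *: v^T = (c *: v)^T) ?trmxK // linearZ.
  have adc : adapted mul E (c *: v) e.
    case: ad => ee ad; split=> // a b /ad[d [s [Es mulE]]]; exists d, s; split=> //.
    by rewrite -!scalemxAr Es !scalerA mulrC.
  exists (frame E (c *: v) e); split.
  - by exists e; exact: (frame_intertwining mulP E_cliff adc).
  - exact: (frame_orthonormal mulP E_cliff adc vc).
  - have Mcv : M *m (c *: v) = c *: v by rewrite -scalemxAr Mv.
    apply/row_matrixP => i; rewrite row_mul rowK; case: unliftP => [a|] _.
      by rewrite -{1}M_sym -trmx_mul -scalemxAr mulmxA M_comm -mulmxA Mcv.
    by rewrite -{1}M_sym -trmx_mul Mcv.
have [j [b [jl [Qb b_orth] b1]]] :=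
  orthonormal_blocks_exist (isT : (0 < q.+1)%N) Q_comm Q_ext.
(* Each block only comes with the existence of a sign; it is recorded by deciding classically
   whether 1 is such a sign. *)
exists j, b, (fun i => `[< intertwining_block mul E (b i) 1 >]); split=> //.
split=> // i /Qb[e be]; rewrite /signb; case: asboolP => // n1.
have [/eqP] := be; rewrite -expr2 sqrf_eq1 => /orP[/eqP e1|/eqP eN1] _.
  by rewrite e1 in be.
by rewrite eN1 in be.
Qed.

Section Decomposition.
Variables (j : nat) (b : nat -> 'M[R]_(q.+1, l)) (plus : nat -> bool).
Hypothesis b_dec : block_decomposition j b plus.

(** Inserting the sum of the b_i^T b_i splits the trace into blocks; on a block of sign e the
    product is - e^q = - e times the identity. *)
Lemma trace_prod_skew : odd q -> \prod_(a < q) unit_mx mul a = - 1%:M ->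
  \tr (\prod_(a < q) E a) = - (q.+1%:R * \sum_(i < j) signb (plus i)).
Proof.
move=> q_odd vol; have [bE b_orth b1] := b_dec.
have prodE (s : seq 'I_q) i : (i < j)%N -> b i *m \prod_(a <- s) E a =
    signb (plus i) ^+ size s *: (\prod_(a <- s) unit_mx mul a *m b i).
  move=> ij; have [_ bEi] := bE i ij; elim: s => [|a s IHs].
    by rewrite !big_nil scale1r mulmx1 mul1mx.
  rewrite !big_cons mulmxA bEi -scalemxAl -mulmxA IHs -scalemxAr scalerA.
  by rewrite -exprS mulmxA.
have signb_odd c : signb c ^+ q = signb c.
  by case: c; rewrite /signb ?expr1n // -signr_odd q_odd.
have prodEi (i : 'I_j) : b i *m \prod_(a < q) E a = - signb (plus i) *: b i.
  rewrite prodE // vol mulNmx mul1mx scalerN scaleNr.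
  by rewrite (_ : size _ = q) ?signb_odd // -[RHS]card_ord cardT /index_enum enumT.
rewrite -[\prod_(a < q) E a]mul1mx -b1 mulmx_suml.
rewrite (big_morph _ (@mxtraceD R l) (mxtrace0 R l)) mulr_sumr -sumrN.
apply: eq_bigr => i _; rewrite -mulmxA prodEi -scalemxAr mxtraceZ mxtrace_mulC.
by rewrite b_orth // eqxx mxtrace1 mulNr mulrC.
Qed.

(** The sum of the signs forces p + 1 positive blocks, as many as the model has rows with i < p or i
    = n. A permutation s matches the kinds, and Phi lists the coordinates of x in the blocks in that
    order. *)
Lemma identification_of_blocks (n p : nat) : j = n.+1 -> (p <= n)%N ->
  \sum_(i < j) signb (plus i) = 2 * p%:R - n.+1%:R + 2 ->
  exists Phi : 'cV[R]_l -> 'M[R]_(n.+1, q.+1), std_identification mul p E Phi.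
Proof.
move=> jE pn; subst j; case: b_dec => bE b_orth b1 sumE.
pose model (i : 'I_n.+1) : bool := (i < p)%N || (i == ord_max).
have signb_sum (c : 'I_n.+1 -> bool) :
    \sum_i signb (c i) = 2 * (\sum_i (c i : nat))%:R - n.+1%:R.
  have -> : n.+1%:R = \sum_(i < n.+1) (1 : R) by rewrite sumr_const card_ord.
  rewrite natr_sum mulr_sumr -sumrB; apply: eq_bigr => i _.
  by case: (c i); rewrite /signb /=; ring.
have model_count : (\sum_i (model i : nat) = p.+1)%N.
  rewrite big_ord_recr /= {2}/model eqxx orbT addn1; congr _.+1.
  rewrite (eq_bigr (fun i : 'I_n => ((i < p)%N : nat))) => [|i _].
    by rewrite -big_mkcond /= (big_ord_narrow pn) sum1_card card_ord.
  rewrite /model (_ : (_ == ord_max) = false) ?orbF //.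
  by apply/negbTE; rewrite -val_eqE /= neq_ltn ltn_ord.
have plus_count : (\sum_(i < n.+1) (plus i : nat) = p.+1)%N.
  apply/eqP; rewrite -(eqr_nat R); apply/eqP.
  have := signb_sum (fun i => plus i); rewrite sumE -(natr1 p) => e; lra.
have [s sE] : exists s : {perm 'I_n.+1}, forall i, model i = plus (s i).
  pose t1 := [tuple model i | i < n.+1]; pose t2 := [tuple plus i | i < n.+1].
  have count_t (c : 'I_n.+1 -> bool) :
      count_mem true [tuple c i | i < n.+1] = (\sum_i (c i : nat))%N.
    rewrite count_map -sum1_count big_mkcond /= big_enum /=.
    by apply: eq_bigr => i _; case: (c i).
  have /tuple_permP[s ts] : perm_eq t1 t2.
    apply/allP => x _; have ct : count_mem true t1 = count_mem true t2.
      by rewrite !count_t model_count plus_count.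
    case: x => //=; first by rewrite ct.
    have cf t : count_mem false t = (size t - count_mem true t)%N.
      rewrite -(count_predC (pred1 true)) addKn.
      by apply: eq_count => -[].
    by rewrite !cf ct !size_tuple.
  exists s => i; have := congr1 (fun t => nth true t i) ts.
  by rewrite -!tnth_nth !tnth_mktuple.
pose Phi (x : 'cV[R]_l) : 'M[R]_(n.+1, q.+1) := \matrix_i (b (s i) *m x)^T.
pose Psi (z : 'M[R]_(n.+1, q.+1)) := \sum_i (b (s i))^T *m (row i z)^T.
have sum_s : \sum_i (b (s i))^T *m b (s i) = 1%:M.
  by rewrite -b1 [RHS](reindex_inj (@perm_inj _ s)).
have PhiK : cancel Phi Psi.
  move=> x; rewrite /Psi -[RHS]mul1mx -sum_s mulmx_suml; apply: eq_bigr => i _.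
  by rewrite rowK trmxK mulmxA.
have PsiK : cancel Psi Phi.
  move=> z; apply/row_matrixP => i; rewrite rowK /Psi mulmx_sumr (bigD1 i) //=.
  rewrite mulmxA b_orth // eqxx mul1mx big1 ?addr0 ?trmxK // => k ki.
  rewrite mulmxA b_orth // (inj_eq val_inj) (inj_eq (@perm_inj _ s)) eq_sym.
  by rewrite (negbTE ki) mul_scalar_mx scale0r.
exists Phi; split.
- move=> c x y; apply/row_matrixP => i; rewrite linearP /= !rowK mulmxDr -scalemxAr.
  by rewrite linearP.
- by exists Psi.
- move=> x y; rewrite !dotE -[in RHS](mul1mx x) -sum_s mulmx_suml mulmx_suml.
  rewrite (big_morph _ (@mxtraceD R l) (mxtrace0 R l)) -dotE dot_rows.
  apply: eq_bigr => i _.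
  rewrite dotE !rowK trmxK mxtrace_mulC trmx_mul mulmxA mxtrace_mulC.
  rewrite -[in RHS]mxtrace_tr !trmx_mul !trmxK -mulmxA [RHS]mxtrace_mulC.
  by rewrite [RHS]mxtrace_mulC [in RHS]mulmxA [RHS]mxtrace_mulC !mulmxA.
- move=> a x; apply/row_matrixP => i; rewrite !rowK -/(model i) sE mulmxA.
  have [_ ->] := bE (s i) (ltn_ord _); rewrite -scalemxAl -mulmxA.
  rewrite -[b (s i) *m x]trmxK (unit_mxE mulP) linearZ /= !trmxK.
  by case: (plus _); rewrite /signb ?scale1r ?scaleN1r.
Qed.

End Decomposition.

End BlockDecomposition.

(** With J = P_0 P_1 and D(B) = diag(B, B), which commute, P_{1+a} is J D(E_a). The product of all
    operators is J^(q+1) D(E_1 ... E_q), and J^4 = 1 while 4 divides q + 1. *)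
Lemma normal_form_trace (R : realType) (q l : nat) (P : 'I_q.+2 -> 'M[R]_(l + l))
    (A : 'M[R]_(l + l)) (E : 'I_q -> 'M[R]_l) :
  (4 %| q.+1)%N -> clifford_normal_form P A E ->
  \tr (\prod_(i < q.+2) P i) = 2 * \tr (\prod_(a < q) E a).
Proof.
move=> q4 [[AtA _] AP0 AP1 APa].
have AAt : A *m A^T = 1%:M by apply: mulmx1C.
have conj_prod (s : seq 'I_q.+2) : A *m \prod_(i <- s) P i *m A^T =
    \prod_(i <- s) (A *m P i *m A^T).
  elim: s => [|i s IHs]; first by rewrite !big_nil mulmx1.
  rewrite !big_cons -IHs -!mulmxE !mulmxA -(mulmxA _ A^T A) AtA mulmx1.
  by [].
have -> : \tr (\prod_(i < q.+2) P i) = \tr (\prod_(i < q.+2) (A *m P i *m A^T)).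
  by rewrite -conj_prod mxtrace_mulC mulmxA AtA mul1mx.
pose J : 'M[R]_(l + l) := block_mx 0 1%:M (- 1%:M) 0.
pose D (B : 'M[R]_l) : 'M[R]_(l + l) := block_mx B 0 0 B.
have JD B : J *m D B = block_mx 0 B (- B) 0.
  rewrite mulmx_block !(mul0mx, mulmx0, mul1mx, mulNmx, add0r, addr0).
  by [].
have DJ B : D B *m J = J *m D B.
  rewrite JD mulmx_block !(mul0mx, mulmx0, mulmx1, mulmxN, add0r, addr0).
  by [].
have DD B C : D B *m D C = D (B *m C).
  by rewrite mulmx_block !(mul0mx, mulmx0, add0r, addr0).
have J4 : J *m J *m (J *m J) = 1%:M.
  have JJ : J *m J = - 1%:M.
    rewrite mulmx_block !(mul0mx, mulmx0, mul1mx, mulmx1, add0r, addr0).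
    by rewrite scalar_mx_block opp_block_mx !oppr0.
  by rewrite JJ mulmxN mulmx1 opprK.
have prodJ (s : seq 'I_q) : \prod_(a <- s) (J *m D (E a)) =
    J ^+ size s *m D (\prod_(a <- s) E a).
  elim: s => [|a s IHs].
    by rewrite !big_nil expr0 mul1mx; exact: scalar_mx_block.
  rewrite !big_cons IHs -!mulmxE exprS -!mulmxE -DD.
  have JnD n B : J ^+ n *m D B = D B *m J ^+ n.
    elim: n => [|n IHn]; first by rewrite expr0 mulmx1 mul1mx.
    by rewrite exprSr -!mulmxE -mulmxA -DJ mulmxA IHn mulmxA.
  by rewrite -!mulmxA; congr (J *m _); rewrite !mulmxA JnD.
rewrite !big_ord_recl AP0 AP1 -!mulmxE.
under eq_bigr => a _ do rewrite APa -JD.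
rewrite prodJ mulmxA.
have -> : block_mx 1%:M 0 0 (- 1%:M) *m block_mx 0 1%:M 1%:M 0 = J.
  rewrite mulmx_block !(mul0mx, mulmx0, mul1mx, mulmx1, mulNmx, add0r, addr0).
  by [].
rewrite mulmxA (_ : size _ = q); last first.
  by rewrite -[RHS]card_ord cardT /index_enum enumT.
have -> : J *m J ^+ q = 1%:M.
  rewrite mulmxE -exprS; case/dvdnP: q4 => d ->; rewrite mulnC exprM.
  suff -> : J ^+ 4 = 1 by rewrite expr1n.
  by rewrite !exprS expr0 mulr1 mulrA.
by rewrite mul1mx mxtrace_block mulr2n mulrDl mul1r.
Qed.

(** Both cases at once: m = q + 1 is the dimension of F, and 2 (q + 1) is 8 or 16. *)
Lemma clifford_characteristic_map (R : realType) (q n l p : nat)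
    (mul : 'rV[R]_q.+1 -> 'rV[R]_q.+1 -> 'rV[R]_q.+1)
    (P : 'I_q.+2 -> 'M[R]_(l + l)) :
  composition_algebra mul -> has_adapted_vectors mul ->
  \prod_(a < q) unit_mx mul a = - 1%:M -> (4 %| q.+1)%N ->
  (l = n.+1 * q.+1)%N -> (p <= n)%N -> clifford_system P ->
  \tr (\prod_(i < q.+2) P i) =
    - (2 * q.+1%:R * (2 * p%:R - n.+1%:R + 2)) ->
  (exists A E, clifford_normal_form P A E) /\
  forall A E, clifford_normal_form P A E ->
    (exists Phi : 'cV[R]_l -> 'M[R]_(n.+1, q.+1), std_identification mul p E Phi) /\
    forall (Phi : 'cV[R]_l -> 'M[R]_(n.+1, q.+1)) (N : 'cV[R]_l),
      std_identification mul p E Phi -> Phi N = north_pole ->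
      is_characteristic_map (eta_fiber E) N (fun z => char_map mul p (Phi z)).
Proof.
move=> mulP adv vol q4 lE pn P_cliff trP; split; first exact: normal_form_exists.
have q_odd : odd q.
  by move: q4; rewrite -[odd q]negbK -oddS -dvdn2; apply: dvdn_trans.
move=> A E PAE; split=> [|Phi N PhiP PhiN]; last first.
  case: (PhiP) => _ [Psi PhiK PsiK] _ _.
  by apply: (characteristic_map_eta mulP PhiP PhiK PsiK) => //; exact: odd_gt0.
have [[_ E_cliff] _ _ _] := PAE.
have [j [b [plus [jl b_dec]]]] := block_decomposition_exists mulP E_cliff adv.
have jE : j = n.+1 by apply/eqP; rewrite -(eqn_pmul2r (ltn0Sn q)) jl lE.
apply: (identification_of_blocks mulP b_dec jE pn).
have := normal_form_trace q4 PAE.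
rewrite trP (trace_prod_skew b_dec q_odd vol) mulrN mulrA => /oppr_inj/mulfI -> //.
Qed.

(** Normal form and identification are not unique: the map is computed for every choice of them, and
    their existence is asserted too, so that the claim is not vacuous. *)
Theorem theorem1 (R : realType) (k p : nat) (k_gt0 : (0 < k)%N)
    (p_le : (p <= k.-1)%N) :
  ((0 < 4 * k - 4 - 1)%N ->
   forall P : 'I_5 -> 'M[R]_(4 * k + 4 * k),
   clifford_system P ->
   \tr (\prod_(i < 5) P i) = - 8 * (2 * p%:R - k%:R + 2) ->
   (exists A E, clifford_normal_form P A E) /\
   forall A E, clifford_normal_form P A E ->
     (exists Phi : 'cV[R]_(4 * k) -> 'M[R]_(k.-1.+1, 4),
        std_identification (@qmul R) p E Phi) /\
     forall (Phi : 'cV[R]_(4 * k) -> 'M[R]_(k.-1.+1, 4)) (N : 'cV[R]_(4 * k)),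
       std_identification (@qmul R) p E Phi -> Phi N = north_pole ->
       is_characteristic_map (eta_fiber E) N (fun z => char_map (@qmul R) p (Phi z)))
  /\
  ((0 < 8 * k - 8 - 1)%N ->
   forall P : 'I_9 -> 'M[R]_(8 * k + 8 * k),
   clifford_system P ->
   \tr (\prod_(i < 9) P i) = - 16 * (2 * p%:R - k%:R + 2) ->
   (exists A E, clifford_normal_form P A E) /\
   forall A E, clifford_normal_form P A E ->
     (exists Phi : 'cV[R]_(8 * k) -> 'M[R]_(k.-1.+1, 8),
        std_identification (@omul R) p E Phi) /\
     forall (Phi : 'cV[R]_(8 * k) -> 'M[R]_(k.-1.+1, 8)) (N : 'cV[R]_(8 * k)),
       std_identification (@omul R) p E Phi -> Phi N = north_pole ->
       is_characteristic_map (eta_fiber E) N (fun z => char_map (@omul R) p (Phi z))).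
Proof.
case: k k_gt0 p_le => // n _ p_le.
split=> _ P P_cliff trP.
  apply: (clifford_characteristic_map (@qmul_composition R)
    (@quaternion_adapted_vectors R) _ _ _ p_le P_cliff) => //.
  - exact: (prod_unit_mx (@qmul_composition R) isT (quaternion_word R)).
  - by rewrite mulnC.
  - by rewrite trP; ring.
apply: (clifford_characteristic_map (@omul_composition R)
  (@octonion_adapted_vectors R) _ _ _ p_le P_cliff) => //.
- by apply: (prod_unit_mx (@omul_composition R) isT); exact: octonion_word.
- by rewrite mulnC.
- by rewrite trP; ring.
Qed.
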